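(* Let $n\geq 1$ be an integer. There exists a subset $E\subset \mathbb R^n$ avoiding repeated distances (i.e. for all $x,y,x',y'\in E$ with $x\neq y$, $x'\neq y'$ and $\{x,y\}\neq\{x',y'\}$, one has $\|x-y\|\neq\|x'-y'\|$) that has full outer Lebesgue measure, i.e. $\lambda^n_*(\mathbb R^n\setminus E)=0$ (and consequently Hausdorff dimension $n$).
   Context: $\lambda^n_*$ denotes $n$-dimensional inner Lebesgue measure and $\|\cdot\|$ the Euclidean norm. The axiom of choice is assumed. *)

(* Defs.v *)
From HB Require Import structures.
From mathcomp Require Import all_boot all_order all_algebra.
From mathcomp Require Import all_classical all_reals all_analysis.

Set Implicit Arguments.
Unset Strict Implicit.
Unset Printing Implicit Defensive.

Import Order.TTheory GRing.Theory Num.Theory.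
Import numFieldNormedType.Exports.

Local Open Scope classical_set_scope.
Local Open Scope ring_scope.

(* The library norm `|x| on 'rV[R]_n is the sup norm, hence [enorm]. *)
Definition enorm (R : realType) (n : nat) (x : 'rV[R]_n) : R :=
  Num.sqrt (\sum_(i < n) x ord0 i ^+ 2).

Definition avoids_repeated_distances (R : realType) (n : nat)
    (E : set 'rV[R]_n) : Prop :=
  forall x y x' y' : 'rV[R]_n, E x -> E y -> E x' -> E y' ->
    x <> y -> x' <> y' -> [set x; y] <> [set x'; y'] ->
    enorm (x - y) <> enorm (x' - y').

Definition closed_box (R : realType) (n : nat) (a b : 'rV[R]_n) :
    set 'rV[R]_n :=
  [set x | forall i, a ord0 i <= x ord0 i <= b ord0 i].

Definition box_volume (R : realType) (n : nat) (a b : 'rV[R]_n) : R :=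
  \prod_(i < n) (b ord0 i - a ord0 i).

(* Countable covers by nonempty closed boxes, degenerate ones being allowed.
   For n = 0 every box has volume 1, so this is only meant for n > 0. *)
Definition lebesgue_outer (R : realType) (n : nat) (A : set 'rV[R]_n) :
    \bar R :=
  ereal_inf [set v | exists a b : nat -> 'rV[R]_n,
    [/\ forall k i, a k ord0 i <= b k ord0 i,
        A `<=` \bigcup_k closed_box (a k) (b k) &
        v = (\sum_(0 <= k <oo) (box_volume (a k) (b k))%:E)%E]].

(* The inner measure: supremum of the Lebesgue measures of the Lebesgue
   measurable subsets, Lebesgue measure being [lebesgue_outer] restricted to
   its Caratheodory-measurable sets. *)
Definition lebesgue_inner (R : realType) (n : nat) (A : set 'rV[R]_n) :
    \bar R :=
  ereal_sup [set lebesgue_outer B | B in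
    [set B | caratheodory_measurable (@lebesgue_outer R n) B /\ B `<=` A]].

(* The maximum with 0 only matters for the empty set, which gets diameter 0. *)
Definition ediam (R : realType) (n : nat) (U : set 'rV[R]_n) : \bar R :=
  maxe 0%E (ereal_sup
    [set r | exists x y, [/\ U x, U y & r = (enorm (x - y))%:E]]).

(* diam(U)^s, with 0^0 = 1 for singletons but the empty set contributing 0 for
   every s, so that the case s = 0 yields the counting measure. *)
Definition diam_pow (R : realType) (n : nat) (s : R) (U : set 'rV[R]_n) :
    \bar R :=
  if `[< U = set0 >] then 0%E else (ediam U `^ s)%E.

Definition hausdorff_premeasure (R : realType) (n : nat) (s delta : R)
    (A : set 'rV[R]_n) : \bar R :=
  ereal_inf [set v | exists U : nat -> set 'rV[R]_n,
    [/\ forall k, (ediam (U k) <= delta%:E)%E,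
        A `<=` \bigcup_k U k &
        v = (\sum_(0 <= k <oo) diam_pow s (U k))%E]].

Definition hausdorff_measure (R : realType) (n : nat) (s : R)
    (A : set 'rV[R]_n) : \bar R :=
  ereal_sup [set hausdorff_premeasure s delta A | delta in [set d : R | 0 < d]].

Definition hausdorff_dim (R : realType) (n : nat) (A : set 'rV[R]_n) :
    \bar R :=
  ereal_inf [set s%:E | s in [set s : R | 0 <= s /\ hausdorff_measure s A = 0%E]].

(* Main.v *)
(** The continuum-many compact sets of positive outer measure are enumerated along a
    well-order all of whose initial segments have fewer than continuum many
    elements, and a point is picked from each of them, avoiding all the spheres
    [|x - y| = |x' - y'|] and all the bisectors [|x - y| = |x - y'|] spanned by the
    points [F] picked before. Such a point exists because a compact set [K] with
    [lambda K > 0] contains, in any given direction [v], a set of continuum many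
    collinear points: by Steinhaus' argument [K] meets its small translates along
    [v] in positive measure, and iterating this produces a Cantor set on a line.
    Choosing [v] not orthogonal to any [y - y'], each forbidden sphere or bisector
    contains at most two points of that line, and since [F] has cardinality
    [k < c], there are fewer than [c] of them ([k * k = k] for infinite [k]).
    The resulting set meets every compact set of positive measure, so its
    complement has inner measure zero and the set itself is not Lebesgue null,
    hence not null for any Hausdorff measure of dimension [s <= n]. *)

Require Import Defs.
From HB Require Import structures.
From mathcomp Require Import finmap.
From mathcomp Require Import all_boot all_order all_algebra.
From mathcomp Require Import all_classical all_reals all_analysis.
From mathcomp Require Import ring lra.
From mathcomp Require wochoice.

Import Order.TTheory GRing.Theory Num.Theory.
Import numFieldNormedType.Exports.

Local Open Scope classical_set_scope.
Local Open Scope ring_scope.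

(** * Cardinality and transfinite choice *)

(** The cardinal inequality between [A] and [B]. The map is total on [T], so an inhabitant of the
    target type is needed wherever a map is completed by a default value. *)
Definition embeds {T U : Type} (A : set T) (B : set U) : Prop :=
  exists2 f : T -> U, (forall x, A x -> B (f x)) &
    (forall x y, A x -> A y -> f x = f y -> x = y).

Lemma embeds_sub {T : Type} (A B : set T) : A `<=` B -> embeds A B.
Proof. by move=> AB; exists id. Qed.

Lemma embeds_trans {T U V : Type} (B : set U) (A : set T) (C : set V) :
  embeds A B -> embeds B C -> embeds A C.
Proof.
move=> [f fB fi] [g gC gi]; exists (g \o f) => [x Ax|x y Ax Ay /= gf].
  exact/gC/fB.
by apply: fi => //; apply: gi => //; exact: fB.
Qed.

Lemma embeds_image {T U : Type} (f : T -> U) (A : set T) :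
  inhabited T -> embeds (f @` A) A.
Proof.
move=> [t0].
have /choice[g gP] : forall u, exists t, (f @` A) u -> A t /\ f t = u.
  move=> u; have [[t At <-]|nu] := pselect ((f @` A) u); first by exists t.
  by exists t0.
exists g => [u /gP[]//|u v /gP[_ fu] /gP[_ fv] guv].
by rewrite -fu -fv guv.
Qed.

Lemma embeds_setX {T U T' U' : Type} (A : set T) (B : set U) (A' : set T')
    (B' : set U') :
  embeds A A' -> embeds B B' -> embeds (A `*` B) (A' `*` B').
Proof.
move=> [f fA fi] [g gB gi]; exists (fun p => (f p.1, g p.2)).
  by move=> [x y] [/= /fA ? /gB ?].
move=> [x y] [x' y'] [/= Ax By] [/= Ax' By'] [fx gy].
by rewrite (fi _ _ Ax Ax' fx) (gi _ _ By By' gy).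
Qed.

(** The first coordinate, [c0] or [c1], records which of the two sets an element was taken from. *)
Lemma embeds_setU {T U : Type} (A B : set T) (C : set U) (c0 c1 : U) :
  C c0 -> C c1 -> c0 <> c1 -> embeds A C -> embeds B C ->
  embeds (A `|` B) (C `*` C).
Proof.
move=> Cc0 Cc1 c01 [f fA fi] [g gB gi].
exists (fun x => if pselect (A x) then (c0, f x) else (c1, g x)).
  by move=> x ABx; case: pselect => /= [/fA//|nA]; split=> //=; case: ABx => // /gB.
move=> x y ABx ABy; case: pselect => nAx; case: pselect => nAy //= [].
- exact: fi.
- by move=> /c01.
- by move=> /esym/c01.
- by case: ABx => // Bx; case: ABy => // By; exact: gi.
Qed.

Lemma proper_witness {T : Type} (A B : set T) (x : T) :
  A `<=` B -> B x -> ~ A x -> A `<` B.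
Proof. by move=> AB Bx nAx; split=> // /(_ x Bx). Qed.

Definition partial_injection {T U : Type} (G : set (T * U)) :=
  forall a b a' b', G (a, b) -> G (a', b') -> (a = a' <-> b = b').

Lemma partial_injection_bigcup {T U : Type} (F : set (set (T * U))) :
  (forall G, F G -> partial_injection G) -> total_on F subset ->
  partial_injection (\bigcup_(G in F) G).
Proof.
move=> Finj Ftot a b a' b' [G FG Gab] [H FH Hab].
have [GH|HG] := Ftot _ _ FG FH.
  by apply: (Finj _ FH) => //; exact: GH.
by apply: (Finj _ FG) => //; exact: HG.
Qed.

Lemma partial_injection_embeds {T U : Type} (G : set (T * U)) A B :
  inhabited U -> partial_injection G ->
  (forall a, A a -> exists2 b, B b & G (a, b)) -> embeds A B.
Proof.
move=> [u0] Ginj AB.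
have /choice[f fP] : forall a, exists b, A a -> B b /\ G (a, b).
  move=> a; have [/AB[b Bb Gab]|nA] := pselect (A a); first by exists b.
  by exists u0.
exists f => [x /fP[]//|x y /fP[_ Gx] /fP[_ Gy]].
by case: (Ginj _ _ _ _ Gx Gy).
Qed.

Lemma embeds_total {T U : Type} (A : set T) (B : set U) :
  inhabited T -> inhabited U -> embeds A B \/ embeds B A.
Proof.
move=> t0 u0.
pose P (G : set (T * U)) :=
  partial_injection G /\ forall a b, G (a, b) -> A a /\ B b.
have [F FP Ftot|G [[Ginj GAB] Gmax]] := @Zorn_bigcup _ P.
  split; first by apply: partial_injection_bigcup => // G /FP[].
  by move=> a b [G /FP[_]]; exact.
have [AG|] := pselect (forall a, A a -> exists2 b, B b & G (a, b)).
  by left; exact: partial_injection_embeds AG.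
move=> /existsNP[a /not_implyP[Aa naG]].
have [BG|] := pselect (forall b, B b -> exists2 a, A a & G (a, b)).
  right; apply: (@partial_injection_embeds _ _ [set p | G (p.2, p.1)]) => //.
  by move=> b x b' x' /= Gx Gx'; have := Ginj _ _ _ _ Gx Gx'; tauto.
move=> /existsNP[b /not_implyP[Bb nbG]].
have GE x y : G (x, y) -> x <> a /\ y <> b.
  move=> Gxy; have [Ax By] := GAB _ _ Gxy.
  split=> [xa|yb]; first by apply: naG; exists y => //; rewrite -xa.
  by apply: nbG; exists x => //; rewrite -yb.
exfalso; apply: (Gmax (G `|` [set (a, b)])).
  apply: (proper_witness _ _ (a, b)); first exact: subsetUl.
    by right.
  by move=> /GE[].
split=> [x y x' y'|x y].
- case=> [Gxy|[-> ->]] [Gxy'|[-> ->]] //.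
  + exact: Ginj.
  + by have [] := GE _ _ Gxy.
  + by have [nx ny] := GE _ _ Gxy'; split=> e; [case: nx|case: ny].
- by case=> [/GAB//|[-> ->]].
Qed.

Lemma embeds_natX : embeds [set: nat * nat] [set: nat].
Proof. by exists pickle => // x y _ _; exact: (pcan_inj pickleK). Qed.

(* Maximality, by Zorn's lemma, of an injection [X * X -> X] with [X] an
   infinite subset of [A]: if [X] were smaller than [A] it would have a
   disjoint copy [Y] in [A], and the injection would extend to [X `|` Y]. *)
Lemma embeds_square {T : Type} (A : set T) :
  embeds [set: nat] A -> embeds (A `*` A) A.
Proof.
move=> [f0 f0A f0i].
have t0 : inhabited T := inhabits (f0 0%N).
pose fld (G : set ((T * T) * T)) := [set x | exists z, G ((x, x), z)].
pose P (G : set ((T * T) * T)) := [/\ partial_injection G,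
  forall x y z, G ((x, y), z) -> [/\ fld G x, fld G y & fld G z],
  forall x y, fld G x -> fld G y -> exists z, G ((x, y), z),
  fld G `<=` A & G = set0 \/ embeds [set: nat] (fld G)].
have fldS G H : G `<=` H -> fld G `<=` fld H.
  by move=> GH x [z Gz]; exists z; exact: GH.
have [F FP Ftot|G [[Ginj GX XG XA Ginf] Gmax]] := @Zorn_bigcup _ P.
  have Fsub G : F G -> G `<=` \bigcup_(X in F) X by exact: bigcup_sup.
  split.
  - by apply: partial_injection_bigcup => // G /FP[].
  - move=> x y z [G FG Gxyz]; have [_ GX _ _ _] := FP _ FG.
    have [Xx Xy Xz] := GX _ _ _ Gxyz.
    by split; apply: (@fldS G) => //; exact: Fsub.
  - move=> x y [zx [G FG Gx]] [zy [H FH Hy]].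
    have [GH|HG] := Ftot _ _ FG FH.
      have [_ _ XH _ _] := FP _ FH.
      have [||z Hz] := XH x y; [by exists zx; exact: GH|by exists zy|].
      by exists z; exists H.
    have [_ _ XG _ _] := FP _ FG.
    have [||z Gz] := XG x y; [by exists zx|by exists zy; exact: HG|].
    by exists z; exists G.
  - by move=> x [z [G FG Gz]]; have [_ _ _ XA _] := FP _ FG; apply: XA; exists z.
  - have [F0|/existsNP[G /not_implyP[FG Gn0]]] :=
        pselect (forall G, F G -> G = set0).
      by left; rewrite bigcup0.
    right; have [_ _ _ _ [//|nG]] := FP _ FG.
    by apply: embeds_trans nG _; apply: embeds_sub; exact/fldS/Fsub.
have {Ginf}ninf : embeds [set: nat] (fld G).
  (* The empty graph is not maximal: a pairing function carried over to the copy [f0] of the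
     integers extends it. *)
  case: Ginf => // G0; exfalso.
  have [g _ gi] := embeds_natX.
  pose G0' : set ((T * T) * T) :=
    range (fun ij : nat * nat => ((f0 ij.1, f0 ij.2), f0 (g ij))).
  have fldE i : fld G0' (f0 i) by exists (f0 (g (i, i))); exists (i, i).
  apply: (Gmax G0').
    rewrite G0; apply: (proper_witness _ _ ((f0 0%N, f0 0%N), f0 (g (0%N, 0%N)))) => //.
    by exists (0%N, 0%N).
  have fldI x : fld G0' x -> exists i, x = f0 i.
    by move=> [z [[i j] _ /= [<- _ _]]]; exists i.
  split.
  - move=> _ _ _ _ [[i j] _ [<- <-]] [[k l] _ [<- <-]] /=; split.
      by move=> [/(f0i _ _ I I) -> /(f0i _ _ I I) ->].
    by move=> /(f0i _ _ I I) /(gi _ _ I I) [-> ->].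
  - by move=> _ _ _ [[i j] _ [<- <- <-]].
  - by move=> x y /fldI[i ->] /fldI[j ->]; exists (f0 (g (i, j))); exists (i, j).
  - by move=> x /fldI[i ->]; exact: f0A.
  - by right; exists f0.
set X := fld G in GX XG XA ninf.
have XX : embeds (X `*` X) X.
  apply: (partial_injection_embeds G) => // -[x y] [/= Xx Xy].
  by have [z Gz] := XG _ _ Xx Xy; exists z => //; have [] := GX _ _ _ Gz.
have [c0 [c1 [Xc0 Xc1 c01]]] : exists c0 c1, [/\ X c0, X c1 & c0 <> c1].
  have [h hX hi] := ninf; exists (h 0%N), (h 1%N); split; [exact: hX|exact: hX|].
  by move=> /(hi _ _ I I).
have XUX B : embeds B X -> embeds (X `|` B) X.
  move=> BX; apply: embeds_trans XX.
  by apply: (embeds_setU X B X c0 c1) => //; exact: embeds_sub.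
(* Either the rest of [A] is no larger than [X], and then [A] itself embeds into [X], or [X] has a
   copy in [A] outside [X], which will contradict maximality. *)
have [AX|XA'] := embeds_total (A `\` X) X t0 t0.
  have {}AX : embeds A X.
    apply: embeds_trans (XUX _ AX); apply: embeds_sub => x Ax.
    by have [Xx|nXx] := pselect (X x); [left|right].
  apply: embeds_trans (embeds_setX _ _ _ _ AX AX) _.
  by apply: embeds_trans XX _; exact: embeds_sub.
exfalso; case: XA' => f fA fi.
pose Y := f @` X.
have YX : embeds Y X by exact: embeds_image.
have XY x : X x -> Y x -> False by move=> Xx [y /fA[_ nX] yx]; rewrite yx in nX.
have [h hY hi] : embeds ((X `|` Y) `*` (X `|` Y)) Y.
  apply: embeds_trans (embeds_setX _ _ _ _ (XUX _ YX) (XUX _ YX)) _.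
  apply: embeds_trans XX _; exists f => // x Xx; exact: imageP.
(* The new pairs are sent injectively into [Y], which is disjoint from [X], so no value of [H]
   collides with a value of [G]. *)
pose H := [set p : (T * T) * T |
  [/\ (X `|` Y) p.1.1, (X `|` Y) p.1.2, ~ (X p.1.1 /\ X p.1.2) & p.2 = h p.1]].
have fldI x : fld (G `|` H) x <-> (X `|` Y) x.
  split=> [[z [Gz|[]//]]|]; first by left; exists z.
  move=> XYx; have [Xx|nXx] := pselect (X x).
    by have [z Gz] := XG _ _ Xx Xx; exists z; left.
  by exists (h (x, x)); right; split=> //= -[].
have HY p z : H (p, z) -> Y z by move=> [/= ? ? ? ->]; exact: hY.
have GXz p z : G (p, z) -> [/\ X p.1, X p.2 & X z] by case: p => x y /GX.
apply: (Gmax (G `|` H)).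
  apply: (proper_witness _ _ ((f c0, f c0), h (f c0, f c0))).
  - exact: subsetUl.
  - by right; split=> /=; [right; exact: imageP|right; exact: imageP|
      move=> [/XY n _]; apply: n; exact: imageP|].
  - by move=> /GXz[/= /XY n _ _]; apply: n; exact: imageP.
split.
- move=> p z p' z' [Gz|Hz] [Gz'|Hz'].
  + exact: Ginj.
  + have [? ? Xz] := GXz _ _ Gz; have Yz' := HY _ _ Hz'.
    split=> [e|e]; last by rewrite e in Xz; exfalso; exact: XY Xz Yz'.
    by case: Hz' => /= _ _ []; rewrite -e.
  + have [? ? Xz] := GXz _ _ Gz'; have Yz' := HY _ _ Hz.
    split=> [e|e]; last by rewrite -e in Xz; exfalso; exact: XY Xz Yz'.
    by case: Hz => /= _ _ []; rewrite e.
  + case: Hz => /= a b _ ->; case: Hz' => /= a' b' _ ->.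
    by split=> [->//|]; apply: hi.
- move=> x y z [/GX[? ? ?]|Hz]; first by split; apply/fldI; left.
  split; apply/fldI; try by case: Hz.
  by right; exact: HY Hz.
- move=> x y /fldI XYx /fldI XYy; have [[Xx Xy]|n] := pselect (X x /\ X y).
    by have [z Gz] := XG _ _ Xx Xy; exists z; left.
  by exists (h (x, y)); right.
- by move=> x /fldI[/XA//|[y /fA[Ay _] <-]].
- right; apply: embeds_trans ninf _; apply: embeds_sub => x Xx.
  by apply/fldI; left.
Qed.

Lemma not_embeds_cantor : ~ embeds [set: nat -> bool] [set: nat].
Proof.
move=> [f _ fi].
(* Cantor's diagonal sequence: it differs from every [e] at the index [f e]. *)
pose d n := ~~ `[< exists2 e, f e = n & e n >].
have : d (f d) = ~~ d (f d).
  rewrite {1}/d; congr negb; apply/asboolP/idP => [[e fe en]|dd].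
    by move: en; rewrite (fi _ _ I I fe).
  by exists d.
by case: (d _).
Qed.

(** The counting argument behind every choice of a point or direction: [e] parametrizes candidates,
    a triple of points of [F] parametrizes an obstruction, and each obstruction excludes countably
    many candidates. If all were excluded, the Cantor space would embed into the product of the cube
    of [F] with the integers. *)
Lemma not_embeds_cantor_fibers {V : Type} (F : set V)
    (Rel : (nat -> bool) -> V * V * V -> Prop) :
  ~ embeds [set: nat -> bool] F ->
  (forall p, (F `*` F `*` F) p -> embeds [set e | Rel e p] [set: nat]) ->
  exists e, forall p, (F `*` F `*` F) p -> ~ Rel e p.
Proof.
move=> nF fib; apply: contrapT => /forallNP nex.
have {}nex e : exists p, (F `*` F `*` F) p /\ Rel e p.
  by have /existsNP[p /not_implyP[Fp /contrapT]] := nex e; exists p.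
have /choice[f fP] := nex.
have /choice[g gP] : forall p, exists g : (nat -> bool) -> nat,
    (F `*` F `*` F) p -> forall e e', Rel e p -> Rel e' p -> g e = g e' -> e = e'.
  move=> p; have [Fp|nFp] := pselect ((F `*` F `*` F) p); last by exists (fun=> 0%N).
  by have [g _ gi] := fib _ Fp; exists g.
have big : embeds [set: nat -> bool] ((F `*` F `*` F) `*` [set: nat]).
  exists (fun e => (f e, g (f e) e)).
    by move=> e _; split=> //=; have [] := fP e.
  move=> e e' _ _ [ff gg].
  have [Fe Re] := fP e; have [Fe' Re'] := fP e'.
  by apply: (gP _ Fe) => //; rewrite ?gg ff.
have v0 : inhabited V by have [[[v _] _] _] := nex (fun=> false); exact: inhabits.
(* If [F] is infinite, the product embeds into [F] by repeated squaring; otherwise it is countable,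
   against Cantor's theorem. *)
have [nF'|Fn] := embeds_total [set: nat] F (inhabits 0%N) v0.
  apply: nF; apply: embeds_trans big _.
  have FF := embeds_square _ nF'.
  apply: embeds_trans (FF); apply: embeds_setX => //.
  apply: embeds_trans (FF); apply: embeds_setX => //.
  exact: embeds_sub.
apply: not_embeds_cantor; apply: embeds_trans big _.
apply: embeds_trans embeds_natX; rewrite -setXTT.
apply: embeds_setX; last exact: embeds_sub.
apply: embeds_trans embeds_natX; rewrite -setXTT; apply: embeds_setX => //.
by apply: embeds_trans embeds_natX; rewrite -setXTT; apply: embeds_setX.
Qed.

(** * Well-orders and transfinite recursion *)

Lemma well_founded_total_order (T : Type) : exists lt : T -> T -> Prop,
  [/\ well_founded lt, forall x y z, lt x y -> lt y z -> lt x z &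
      forall x y, [\/ x = y, lt x y | lt y x]].
Proof.
elim/Peq : T => T.
have [le lewo] := wochoice.well_ordering_principle T.
have lemin (A : set T) : A !=set0 -> exists2 z, A z & forall y, A y -> le z y.
  move=> [x Ax]; have [|z [[Az zmin] _]] := lewo [pred x | `[< A x >]].
    by exists x; rewrite inE.
  exists z; first by move: Az; rewrite inE.
  by move=> y Ay; apply: zmin; rewrite inE.
have letot x y : le x y \/ le y x.
  have [|z [->|->] zmin] := lemin [set x; y]; first by exists x; left.
    by left; apply: zmin; right.
  by right; apply: zmin; left.
have lexx x : le x x by case: (letot x x).
(* Antisymmetry comes from the uniqueness of the minimum of a pair. *)
have leanti x y : le x y -> le y x -> x = y.
  move=> xy yx; have [|z [_ zu]] := lewo (pred2 x y).
    by exists x; rewrite !inE eqxx.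
  have mx : wochoice.minimum_of le (pred2 x y) x.
    by split; [rewrite !inE eqxx|move=> u; rewrite !inE => /orP[/eqP->|/eqP->]].
  have my : wochoice.minimum_of le (pred2 x y) y.
    by split; [rewrite !inE eqxx orbT|move=> u; rewrite !inE => /orP[/eqP->|/eqP->]].
  by rewrite -(zu _ mx) -(zu _ my).
have letrans x y z : le x y -> le y z -> le x z.
  move=> xy yz; have [|u uE umin] := lemin [set u | [\/ u = x, u = y | u = z]].
    by exists x; constructor 1.
  have ux : le u x by apply: umin; constructor 1.
  have uy : le u y by apply: umin; constructor 2.
  have uz : le u z by apply: umin; constructor 3.
  case: uE => uE; subst u => //.
    by rewrite (leanti _ _ xy ux).
  by rewrite (leanti _ _ uy yz).
exists (fun x y => le x y /\ x <> y); split.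
- move=> x; apply: contrapT => nx.
  have [|z nz zmin] := lemin [set z | ~ Acc (fun x y => le x y /\ x <> y) z].
    by exists x.
  apply: nz; constructor => y [yz ynz]; apply: contrapT => ny.
  by apply: ynz; apply: leanti => //; exact: zmin.
- move=> x y z [xy nxy] [yz nyz]; split; first exact: letrans yz.
  by move=> xz; apply: nxy; apply: leanti => //; rewrite xz.
- move=> x y; have [->|nxy] := pselect (x = y); first by constructor 1.
  by case: (letot x y) => ?; [constructor 2|constructor 3; split => // /esym].
Qed.

(** If some initial segment is as large as [T], take the least [a] bounding such a segment and pull
    the order back along an injection [g] of [T] below [a]. The new segment of [t] embeds below
    [g t], and is therefore smaller than [T]. *)
Lemma initial_well_order (T : Type) : exists lt : T -> T -> Prop,
  [/\ well_founded lt, forall x y z, lt x y -> lt y z -> lt x z,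
      forall x y, [\/ x = y, lt x y | lt y x] &
      forall t, ~ embeds [set: T] [set s | lt s t]].
Proof.
have [lt [ltwf lttr lttot]] := well_founded_total_order T.
have [small|] := pselect (forall t, ~ embeds [set: T] [set s | lt s t]).
  by exists lt.
move=> /existsNP[a0 /contrapT].
elim/(well_founded_ind ltwf) : a0 => a IH [g ga gi].
have [[b ba Tb]|nb] :=
    pselect (exists2 b, lt b a & embeds [set: T] [set s | lt s b]).
  exact: IH ba Tb.
exists (fun x y => lt (g x) (g y)); split.
- suff gAcc y x : g x = y -> Acc (fun x y => lt (g x) (g y)) x.
    by move=> x; exact: gAcc.
  elim/(well_founded_ind ltwf) : y x => y IHy x gx; constructor => z zx.
  by apply: (IHy (g z)) => //; rewrite -gx.
- by move=> x y z; exact: lttr.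
- move=> x y; case: (lttot (g x) (g y)) => [/gi e||];
    by [constructor 1; exact: e|constructor 2|constructor 3].
- move=> t Tt; apply: nb; exists (g t); first exact: ga.
  by apply: embeds_trans Tt _; exists g => // x y _ _; exact: gi.
Qed.

(** [P t F x] reads: at stage [t], with [F] the set of earlier values, [x] may be chosen. The
    earlier values are an image of a proper initial segment, so [T] never embeds into them and the
    recursion does not get stuck. *)
Lemma transfinite_choice (T V : Type) (P : T -> set V -> V -> Prop) :
  inhabited V ->
  (forall t F, ~ embeds [set: T] F -> exists x, P t F x) ->
  exists (e : T -> V) (lt : T -> T -> Prop),
    [/\ forall x y z, lt x y -> lt y z -> lt x z,
        forall x y, [\/ x = y, lt x y | lt y x] &
        forall t, P t (e @` [set s | lt s t]) (e t)].
Proof.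
move=> [v0] exP; have [lt [ltwf lttr lttot ltsmall]] := initial_well_order T.
have /choice[c cP] : forall tF : T * set V, exists x,
    ~ embeds [set: T] tF.2 -> P tF.1 tF.2 x.
  move=> [t F] /=; have [nF|] := pselect (~ embeds [set: T] F); last by exists v0.
  by have [x Px] := exP t F nF; exists x.
pose step t (rec : forall s, lt s t -> V) :=
  c (t, [set v | exists s (h : lt s t), v = rec s h]).
pose e := Fix ltwf (fun=> V) step.
have eE t : e t = c (t, e @` [set s | lt s t]).
  rewrite /e Fix_eq; last first.
    move=> x f g fg; congr (c (x, _)); apply/seteqP.
    by split=> v [s [h ->]]; exists s, h.
  congr (c (t, _)); apply/seteqP; split=> v; first by move=> [s [h ->]]; exists s.
  by move=> [s h <-]; exists s, h.
exists e, lt; split=> // t; rewrite eE; apply: (cP (t, _)) => /= Tt.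
by apply: (ltsmall t); apply: embeds_trans Tt _; exact/embeds_image/inhabits.
Qed.

(** * Infima over countable covers *)

(** Common form of the Lebesgue outer measure and the Hausdorff premeasures, so that monotonicity
    and countable subadditivity are proved once for both. *)
Definition cover_inf {R : realType} {T I : Type} (D : set I) (S : I -> set T)
    (w : I -> \bar R) (A : set T) : \bar R :=
  ereal_inf [set v | exists u : nat -> I,
    [/\ forall k, D (u k), A `<=` \bigcup_k S (u k) &
        v = (\sum_(0 <= k <oo) w (u k))%E]].

Section cover_inf.
Context {R : realType} {T I : Type} (D : set I) (S : I -> set T).
Variable w : I -> \bar R.
Hypothesis w_ge0 : forall i, D i -> (0 <= w i)%E.
Local Open Scope ereal_scope.
Local Notation mu := (cover_inf D S w).

Lemma cover_inf_ge0 A : 0 <= mu A.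
Proof.
by apply: le_ereal_inf_tmp => _ [u [Du _ ->]]; apply: nneseries_ge0 => *; exact: w_ge0.
Qed.

Lemma cover_inf_le_cover A (u : nat -> I) :
  (forall k, D (u k)) -> A `<=` \bigcup_k S (u k) ->
  mu A <= \sum_(0 <= k <oo) w (u k).
Proof. by move=> Du Au; apply: ereal_inf_lbound; exists u. Qed.

Lemma le_cover_inf A B : A `<=` B -> mu A <= mu B.
Proof.
move=> AB; apply: ereal_inf_le_tmp => _ [u [Du Bu ->]]; exists u; split=> //.
exact: subset_trans Bu.
Qed.

Lemma cover_inf_adherent A (e : R) : (0 < e)%R -> mu A < +oo ->
  exists u : nat -> I, [/\ forall k, D (u k), A `<=` \bigcup_k S (u k) &
    \sum_(0 <= k <oo) w (u k) <= mu A + e%:E].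
Proof.
move=> e0 Aoo.
have Afin : mu A \is a fin_num by rewrite ge0_fin_numE// cover_inf_ge0.
have [_ [u [Du Au ->]] /ltW lt] := lb_ereal_inf_adherent e0 Afin.
by exists u.
Qed.

Lemma cover_inf_bigcup (A : nat -> set T) :
  mu (\bigcup_i A i) <= \sum_(0 <= i <oo) mu (A i).
Proof.
have mu0 i : 0 <= mu (A i) by exact: cover_inf_ge0.
have [[i ioo]|/forallNP Aoo] := pselect (exists i, mu (A i) = +oo).
  rewrite (eseries_pinfty _ _ ioo) ?leey// => n _.
  by rewrite -ltNye (lt_le_trans _ (mu0 n)).
apply/lee_addgt0Pr => e e0.
rewrite (le_trans _ (epsilon_trick _ mu0 (ltW e0)))//.
have /choice[u uP] : forall i, exists u : nat -> I,
    [/\ forall k, D (u k), A i `<=` \bigcup_k S (u k) &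
    \sum_(0 <= k <oo) w (u k) <= mu (A i) + (e / (2 ^ i.+1)%:R)%:E].
  move=> i; apply: cover_inf_adherent; first by rewrite divr_gt0// ltr0n expn_gt0.
  by rewrite ltey; apply/eqP.
have w0 i j : 0 <= w (u i j) by apply: w_ge0; case: (uP i).
(* The near-optimal covers of all [A i] are merged into one sequence along a bijection with pairs of
   integers, and the double sum is rearranged. *)
have /card_esym/ppcard_eqP[f] := card_nat2.
apply: (@le_trans _ _ (\sum_(0 <= k <oo) w (u (f k).1 (f k).2))).
  apply: cover_inf_le_cover => [k|x [i _ Aix]]; first by case: (uP (f k).1).
  have [_ /(_ x Aix)[j _ Sj] _] := uP i.
  by exists (f^-1%FUN (i, j)) => //; rewrite invK ?inE.
rewrite nneseries_esumT//.
rewrite -(reindex_esum setT setT f (fun p => w (u p.1 p.2)))//.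
rewrite (_ : [set: nat * nat] = [set: nat] `*`` (fun=> [set: nat])); last first.
  by apply/seteqP; split.
rewrite -(esum_esum (a := fun i j => w (u i j)))//.
rewrite -nneseries_esumT; last by move=> i; exact: esum_ge0.
apply: lee_nneseries => [i _ _|i _]; first exact: esum_ge0.
by rewrite -nneseries_esumT//; case: (uP i).
Qed.

End cover_inf.

(** * Lebesgue outer measure *)

Lemma row_entry_le_norm {R : realType} {n : nat} (x : 'rV[R]_n) i :
  `|x ord0 i| <= `|x|.
Proof.
rewrite [leRHS]/Num.norm /= mx_normrE; apply/bigmax_geP; right => /=.
by exists (ord0, i).
Qed.

Lemma row_norm_lt {R : realType} {n : nat} (x : 'rV[R]_n) r :
  0 < r -> (forall i, `|x ord0 i| < r) -> `|x| < r.
Proof.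
move=> r0 xr; rewrite [ltLHS]/Num.norm /= mx_normrE; apply/bigmax_ltP; split=> //.
by move=> [i j] _ /=; rewrite ord1.
Qed.

Lemma box_volume_ge0 {R : realType} {n : nat} (a b : 'rV[R]_n) :
  (forall i, a ord0 i <= b ord0 i) -> 0 <= box_volume a b.
Proof. by move=> ab; apply: prodr_ge0 => i _; rewrite subr_ge0. Qed.

Lemma lebesgue_outerE {R : realType} {n : nat} :
  @lebesgue_outer R n =
  cover_inf [set ab : 'rV[R]_n * 'rV[R]_n | forall i, ab.1 ord0 i <= ab.2 ord0 i]
    (fun ab => closed_box ab.1 ab.2) (fun ab => (box_volume ab.1 ab.2)%:E).
Proof.
apply/funext => A; congr ereal_inf; apply/seteqP; split=> v.
  by move=> [a [b [ab Aab ->]]]; exists (fun k => (a k, b k)).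
by move=> [u [Du Au ->]]; exists (fst \o u), (snd \o u).
Qed.

Section lebesgue_outer.
Context {R : realType} {n : nat}.
Implicit Types (A B U : set 'rV[R]_n.+1) (a b x y v : 'rV[R]_n.+1).
Local Notation lam := (@lebesgue_outer R n.+1).

Let weight_ge0 (ab : 'rV[R]_n.+1 * 'rV[R]_n.+1) :
  (forall i, ab.1 ord0 i <= ab.2 ord0 i) ->
  (0 <= (box_volume ab.1 ab.2)%:E)%E.
Proof. by move=> ab12; rewrite lee_fin box_volume_ge0. Qed.

Lemma lebesgue_outer_ge0 A : (0 <= lam A)%E.
Proof. by rewrite lebesgue_outerE; exact: cover_inf_ge0. Qed.

Lemma le_lebesgue_outer A B : A `<=` B -> (lam A <= lam B)%E.
Proof. by rewrite lebesgue_outerE; exact: le_cover_inf. Qed.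

Lemma lebesgue_outer_le_cover A (a b : nat -> 'rV[R]_n.+1) :
  (forall k i, a k ord0 i <= b k ord0 i) ->
  A `<=` \bigcup_k closed_box (a k) (b k) ->
  (lam A <= \sum_(0 <= k <oo) (box_volume (a k) (b k))%:E)%E.
Proof. by move=> ab Aab; apply: ereal_inf_lbound; exists a, b. Qed.

Lemma lebesgue_outer_adherent A (e : R) : 0 < e -> (lam A < +oo)%E ->
  exists a b : nat -> 'rV[R]_n.+1, [/\ forall k i, a k ord0 i <= b k ord0 i,
    A `<=` \bigcup_k closed_box (a k) (b k) &
    (\sum_(0 <= k <oo) (box_volume (a k) (b k))%:E <= lam A + e%:E)%E].
Proof.
move=> e0; rewrite lebesgue_outerE.
move=> /(cover_inf_adherent _ _ _ weight_ge0 _ _ e0)[u [Du Au le]].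
by exists (fst \o u), (snd \o u).
Qed.

Lemma lebesgue_outer0 : lam set0 = 0%E.
Proof.
apply/eqP; rewrite eq_le lebesgue_outer_ge0 andbT.
apply: le_trans (lebesgue_outer_le_cover _ (fun=> 0) (fun=> 0) _ _) _ => //.
by rewrite eseries0// => i _ _; rewrite /box_volume big_ord_recl subrr mul0r.
Qed.

Lemma lebesgue_outer_sigma_subadditive : sigma_subadditive lam.
Proof. by move=> F; rewrite lebesgue_outerE; exact: cover_inf_bigcup. Qed.

HB.instance Definition _ := isOuterMeasure.Build R _ lam
  lebesgue_outer0 lebesgue_outer_ge0 le_lebesgue_outer
  lebesgue_outer_sigma_subadditive.

Lemma lebesgue_outer_closed_box a b : (forall i, a ord0 i <= b ord0 i) ->
  (lam (closed_box a b) <= (box_volume a b)%:E)%E.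
Proof.
move=> ab.
pose a' (k : nat) : 'rV[R]_n.+1 := if k is 0%N then a else 0.
pose b' (k : nat) : 'rV[R]_n.+1 := if k is 0%N then b else 0.
apply: le_trans (lebesgue_outer_le_cover _ a' b' _ _) _.
- by case.
- by move=> x abx; exists 0%N.
- rewrite nneseries_recl//; last by move=> [|k] *; rewrite lee_fin; exact: box_volume_ge0.
  rewrite eseries0 ?adde0// => -[|k]// _ _.
  by rewrite /box_volume big_ord_recl subrr mul0r.
Qed.

Lemma lebesgue_outer_addr A v : lam [set x | A (x + v)] = lam A.
Proof.
suff le B (w : 'rV[R]_n.+1) : (lam [set x | B (x + w)%R] <= lam B)%E.
  apply/eqP; rewrite eq_le le/=.
  rewrite (_ : lam A = lam [set x | [set x | A (x + v)] (x - v)]) ?le//.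
  by congr lam; apply/seteqP; split=> x /=; rewrite subrK.
rewrite [leRHS]/lebesgue_outer; apply: le_ereal_inf_tmp => _ [a [b [ab Bab ->]]].
apply: le_trans (lebesgue_outer_le_cover _ (fun k => a k - w) (fun k => b k - w) _ _) _.
- by move=> k i; rewrite !mxE lerD2r.
- move=> x /= /Bab[k _ kx]; exists k => // i; have := kx i.
  by rewrite !mxE lerBlDr lerBrDr.
- rewrite le_eqVlt; apply/orP; left; apply/eqP; apply: eq_eseriesr => k _.
  by congr EFin; apply: eq_bigr => i _; rewrite !mxE; ring.
Qed.

End lebesgue_outer.

(** Linear control, uniform for [h] in the unit interval, of the growth of a box whose sides are all
    lengthened by [h]. *)
Lemma prod_add_le {R : realType} (I : Type) (r : seq I) (l : I -> R) :
  (forall i, 0 <= l i) -> exists2 C, 0 <= C & forall h, 0 <= h <= 1 ->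
    \prod_(i <- r) (l i + h) <= \prod_(i <- r) l i + h * C.
Proof.
move=> l0; elim: r => [|i r [C C0 IH]].
  by exists 0 => // h _; rewrite !big_nil mulr0 addr0.
have P0 : 0 <= \prod_(j <- r) l j by exact: prodr_ge0.
exists (l i * C + \prod_(j <- r) l j + C).
  by rewrite !addr_ge0// mulr_ge0.
move=> h h01; rewrite !big_cons.
apply: le_trans (ler_wpM2l _ (IH h h01)) _.
  by rewrite addr_ge0//; case/andP: h01.
case/andP: h01 => h0 h1.
have : h * (h * C) <= h * C by rewrite ler_wpM2l// ler_piMl.
move: (\prod_(j <- r) l j) (l i) => p q; nra.
Qed.

(** Used with [c = 2] for a margin [h] on both ends of each side, and with [c = 3] to leave room for
    one grid step as well. *)
Lemma box_volume_enlarge {R : realType} {n : nat} (a b : 'rV[R]_n) (e c : R) :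
  (forall i, a ord0 i <= b ord0 i) -> 0 < e -> 0 < c ->
  exists2 h, 0 < h & \prod_i (b ord0 i - a ord0 i + c * h) <= box_volume a b + e.
Proof.
move=> ab e0 c0.
have [|C C0 CP] := prod_add_le _ (index_enum 'I_n) (fun i => b ord0 i - a ord0 i).
  by move=> i; rewrite subr_ge0.
pose h := Num.min 1 (e / (C + 1)).
have h0 : 0 < h by rewrite lt_min ltr01 divr_gt0// ltr_wpDl.
exists (h / c); first by rewrite divr_gt0.
rewrite mulrCA divff ?gt_eqF// mulr1.
apply: le_trans (CP h _) _; first by rewrite (ltW h0) ge_min lexx.
rewrite lerD2l; have : h <= e / (C + 1) by rewrite ge_min lexx orbT.
rewrite ler_pdivlMr ?ltr_wpDl// => he; apply: le_trans he; rewrite mulrDr.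
by rewrite mulr1 lerDl ltW.
Qed.

(** * Outer regularity and measurability of open sets *)

Section lebesgue_regularity.
Context {R : realType} {n : nat}.
Implicit Types (A B U : set 'rV[R]_n.+1) (a b x y v : 'rV[R]_n.+1).
Local Notation lam := (@lebesgue_outer R n.+1).

Lemma lebesgue_outer_open A (e : R) : 0 < e ->
  exists U, [/\ open U, A `<=` U & (lam U <= lam A + e%:E)%E].
Proof.
move=> e0; have [Aoo|] := ltP (lam A) +oo%E; last first.
  rewrite leye_eq => /eqP ->; exists setT; split=> //; first exact: openT.
  by rewrite addye// leey.
have e2 : 0 < e / 2 by rewrite divr_gt0.
have [a [b [ab Aab lab]]] := lebesgue_outer_adherent A (e / 2) e2 Aoo.
have /choice[h hP] : forall k, exists h, 0 < h /\
    \prod_i (b k ord0 i - a k ord0 i + 2 * h) <=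
    box_volume (a k) (b k) + (e / 2) / (2 ^ k.+1)%:R.
  move=> k.
  have ek : 0 < (e / 2) / (2 ^ k.+1)%:R :> R by rewrite divr_gt0// ltr0n expn_gt0.
  have [h h0 hP] := box_volume_enlarge (a k) (b k) _ 2 (ab k) ek (ltr0n R 2).
  by exists h.
(* The open sup-norm neighbourhood of radius [h k] of a box lies in the box with margin [h k]. Half
   of [e] pays for the margins and half for the choice of the cover. *)
pose V k := \bigcup_(y in closed_box (a k) (b k)) ball y (h k).
have h0 k : 0 < h k by case: (hP k).
exists (\bigcup_k V k); split.
- by apply: bigcup_open => k _; apply: bigcup_open => y _; exact: ball_open.
- by move=> x /Aab[k _ kx]; exists k => //; exists x => //; exact: ballxx.
- apply: le_trans (lebesgue_outer_le_cover _ (fun k => a k - const_mx (h k))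
    (fun k => b k + const_mx (h k)) _ _) _.
  + by move=> k i; rewrite !mxE; have := ab k i; have := h0 k; lra.
  + move=> x [k _ [y ky]]; rewrite -ball_normE /= => yx; exists k => // i.
    have := row_entry_le_norm (y - x) i; have := ky i; rewrite !mxE ler_norml; lra.
  + apply: (@le_trans _ _ (\sum_(0 <= k <oo) (box_volume (a k) (b k))%:E + (e / 2)%:E)%E).
      have vol0 k : (0 <= (box_volume (a k) (b k))%:E)%E.
        by rewrite lee_fin box_volume_ge0.
      apply: le_trans (epsilon_trick _ vol0 (ltW e2)).
      apply: lee_nneseries => [k _ _|k _].
        rewrite lee_fin box_volume_ge0// => i; rewrite !mxE.
        by have := ab k i; have := h0 k; lra.
      rewrite -EFinD lee_fin; apply: le_trans (hP k).2.
      rewrite le_eqVlt; apply/orP; left; apply/eqP; apply: eq_bigr => i _.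
      by rewrite !mxE; ring.
    apply: le_trans (leeD2r _ lab) _.
    by rewrite -addeA -EFinD leeD2l// lee_fin; lra.
Qed.

Lemma measurable_halfspace i (c : R) :
  caratheodory_measurable lam [set x : 'rV[R]_n.+1 | x ord0 i < c].
Proof.
apply: le_caratheodory_measurable => X /=.
rewrite [leRHS]/lebesgue_outer; apply: le_ereal_inf_tmp => _ [a [b [ab Xab ->]]].
(* Each box is cut at the hyperplane. Both formulas clamp [c] to the [i]-th side, so the two pieces
   stay nonempty boxes and their volumes add up exactly. *)
pose bl k := \row_j (if j == i then
  Num.max (a k ord0 i) (Num.min (b k ord0 i) c) else b k ord0 j).
pose ar k := \row_j (if j == i then
  Num.min (b k ord0 i) (Num.max (a k ord0 i) c) else a k ord0 j).
have abl k j : a k ord0 j <= bl k ord0 j.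
  by rewrite !mxE; case: eqP => [->|_]; rewrite ?le_max ?lexx.
have arb k j : ar k ord0 j <= b k ord0 j.
  by rewrite !mxE; case: eqP => [->|_]; rewrite ?ge_min ?lexx.
apply: (@le_trans _ _ (\sum_(0 <= k <oo) (box_volume (a k) (bl k))%:E +
    \sum_(0 <= k <oo) (box_volume (ar k) (b k))%:E)%E).
  apply: leeD; apply: lebesgue_outer_le_cover => // x [/Xab[k _ kx] /= xc];
    exists k => // j; have := kx j; rewrite !mxE; case: eqP => [->|//] /andP[ax xb].
    by rewrite ax /= le_max le_min xb (ltW xc) orbT.
  have cx : c <= x ord0 i by rewrite leNgt; exact/negP.
  by rewrite xb andbT ge_min ge_max ax cx orbT.
rewrite -nneseriesD; last 2 first.
- by move=> k _ _; rewrite lee_fin box_volume_ge0.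
- by move=> k _ _; rewrite lee_fin box_volume_ge0.
rewrite le_eqVlt; apply/orP; left; apply/eqP; apply: eq_eseriesr => k _.
rewrite -EFinD; congr EFin; rewrite /box_volume [RHS](bigD1 i)//=.
rewrite [X in X + _](bigD1 i)//= [X in _ + X](bigD1 i)//= !mxE eqxx.
rewrite [X in _ * X + _](eq_bigr (fun j => b k ord0 j - a k ord0 j)); last first.
  by move=> j /negbTE ji; rewrite !mxE ji.
rewrite [X in _ + _ * X](eq_bigr (fun j => b k ord0 j - a k ord0 j)); last first.
  by move=> j /negbTE ji; rewrite !mxE ji.
rewrite -mulrDl; congr (_ * _); have := ab k i.
move: (a k ord0 i) (b k ord0 i) => p q pq.
have /orP[cp|pc] := le_total c p.
  by rewrite (min_r (le_trans cp pq)) (max_l cp) (min_r pq); ring.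
have /orP[cq|qc] := le_total c q; first by rewrite (max_r pc) (min_r cq) (max_r pc); ring.
by rewrite (min_l qc) (max_r pc) (max_r pq) (min_l qc); ring.
Qed.

End lebesgue_regularity.

(** A base of open cubes indexed by the integers: a subset of the integers thus codes an open set.
    Indices that decode to nothing give the empty set. *)
Definition rat_cube (R : realType) (n k : nat) : set 'rV[R]_n :=
  if (unpickle k : option ('rV[rat]_n * rat)) is Some qr then
    [set x | forall i, `|x ord0 i - ratr (qr.1 ord0 i)| < ratr qr.2]
  else set0.

Lemma rat_cube_basis {R : realType} {n : nat} (U : set 'rV[R]_n) x :
  open U -> U x -> exists2 k, rat_cube R n k x & rat_cube R n k `<=` U.
Proof.
move=> oU Ux; have /nbhs_ballP[e /= e0 eU] : nbhs x U by exact: open_nbhs_nbhs.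
(* Two points of a cube of radius [r] are less than [2 * r] apart, hence the bound [e / 2]. *)
have [r] := rat_in_itvoo (divr_gt0 e0 (ltr0n R 2)).
rewrite in_itv/= => /andP[r0 re].
have /choice[q qP] : forall i, exists q : rat, `|x ord0 i - ratr q| < ratr r.
  move=> i; have [|q] := @rat_in_itvoo R (x ord0 i - ratr r) (x ord0 i + ratr r).
    lra.
  by rewrite in_itv/= => qi; exists q; rewrite ltr_norml; lra.
exists (pickle (\row_i q i, r)); rewrite /rat_cube pickleK /=.
  by move=> i; rewrite mxE.
move=> y /= yq; apply: eU; rewrite -ball_normE /=; apply: row_norm_lt => // i.
have := yq i; have := qP i; rewrite !mxE !ltr_norml; lra.
Qed.

Lemma caratheodory_bigcap_ord {R : realType} {T : Type}
    (mu : {outer_measure set T -> \bar R}) (m : nat) (P : 'I_m -> set T) :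
  (forall i, caratheodory_measurable mu (P i)) ->
  caratheodory_measurable mu [set x | forall i, P i x].
Proof.
move=> mP.
rewrite (_ : mkset _ =
    ~` \bigcup_k (if insub k is Some i then ~` P i else set0)); last first.
  apply/seteqP; split=> [x Px [k _]|x nx i].
    by case: insubP => // i _ _; apply.
  apply: contrapT => nPi; apply: nx; exists (val i) => //.
  by rewrite valK.
apply: caratheodory_measurable_setC; apply: caratheodory_measurable_bigcup => k.
case: insubP => [i _ _|_]; last exact: caratheodory_measurable_set0.
exact/caratheodory_measurable_setC/mP.
Qed.

Section lebesgue_measurable.
Context {R : realType} {n : nat}.
Implicit Types (A B U K : set 'rV[R]_n.+1) (a b x y v : 'rV[R]_n.+1).
Local Notation lam := (@lebesgue_outer R n.+1).

Lemma measurable_halfspace_le i (c : R) :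
  caratheodory_measurable lam [set x : 'rV[R]_n.+1 | c <= x ord0 i].
Proof.
rewrite (_ : mkset _ = ~` [set x : 'rV[R]_n.+1 | x ord0 i < c]).
  exact: (caratheodory_measurable_setC (measurable_halfspace i c)).
by apply/seteqP; split=> x /=; rewrite leNgt => /negP.
Qed.

Lemma measurable_halfspace_gt i (c : R) :
  caratheodory_measurable lam [set x : 'rV[R]_n.+1 | c < x ord0 i].
Proof.
rewrite (_ : mkset _ = \bigcup_k [set x : 'rV[R]_n.+1 | c + k.+1%:R^-1 <= x ord0 i]).
  by apply: caratheodory_measurable_bigcup => k; exact: measurable_halfspace_le.
apply/seteqP; split=> [x /= cx|x [k _ /=]].
  have [k] := ltr_add_invr cx; exists k => //=; exact: ltW.
by apply: lt_le_trans; rewrite ltrDl invr_gt0.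
Qed.

Lemma measurable_rat_cube k : caratheodory_measurable lam (rat_cube R n.+1 k).
Proof.
rewrite /rat_cube; case: unpickle => [[q r]|]; last exact: caratheodory_measurable_set0.
apply: (caratheodory_bigcap_ord lam _ (fun i =>
  [set x : 'rV[R]_n.+1 | `|x ord0 i - ratr (q ord0 i)| < ratr r])) => i.
rewrite (_ : mkset _ = [set x : 'rV[R]_n.+1 | ratr (q ord0 i) - ratr r < x ord0 i] `&`
    [set x : 'rV[R]_n.+1 | x ord0 i < ratr (q ord0 i) + ratr r]).
  apply: caratheodory_measurable_setI; first exact: measurable_halfspace_gt.
  exact: measurable_halfspace.
by apply/seteqP; split=> x /=; rewrite ltr_norml => ?; [split|]; lra.
Qed.

Lemma measurable_open U : open U -> caratheodory_measurable lam U.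
Proof.
move=> oU.
rewrite (_ : U = \bigcup_k (if pselect (rat_cube R n.+1 k `<=` U) then
    rat_cube R n.+1 k else set0)).
  apply: caratheodory_measurable_bigcup => k.
  case: pselect => kU; first exact: measurable_rat_cube.
  exact: caratheodory_measurable_set0.
apply/seteqP; split=> [x Ux|x [k _]]; last by case: pselect => // kU /kU.
by have [k kx kU] := rat_cube_basis U x oU Ux; exists k => //; case: pselect.
Qed.

Lemma measurable_closed K : closed K -> caratheodory_measurable lam K.
Proof.
move=> cK; rewrite -[K]setCK; apply: (caratheodory_measurable_setC (mu := lam)).
by apply: measurable_open; exact: closed_openC.
Qed.

End lebesgue_measurable.

(** * Compact sets: inner regularity and small translates *)

Section lebesgue_compact.
Context {R : realType} {n : nat}.
Implicit Types (A B U K : set 'rV[R]_n.+1) (a b x y v : 'rV[R]_n.+1).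
Local Notation lam := (@lebesgue_outer R n.+1).

Lemma compact_closed_box a b : compact (closed_box a b).
Proof.
rewrite (_ : closed_box a b =
    [set x | forall i, `[a ord0 i, b ord0 i]%classic (x ord0 i)]).
  by apply: (@rV_compact R n.+1 (fun i => `[a ord0 i, b ord0 i]%classic)) => i;
    exact: segment_compact.
by apply/seteqP; split=> x abx i; have := abx i; rewrite /= in_itv.
Qed.

Lemma lebesgue_outer_compact_lty K : compact K -> (lam K < +oo)%E.
Proof.
move=> /compact_bounded [M [_ /(_ (`|M| + 1))]].
rewrite (le_lt_trans (ler_norm M)) ?ltrDl// => /(_ isT) KM.
have M0 : 0 <= `|M| + 1 by [].
apply: (@le_lt_trans _ _
  (lam (closed_box (const_mx (- (`|M| + 1))) (const_mx (`|M| + 1))))).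
  apply: le_lebesgue_outer => x /KM /= xM i; rewrite !mxE -ler_norml.
  exact: le_trans (row_entry_le_norm _ _) xM.
apply: le_lt_trans (lebesgue_outer_closed_box _ _ _) (ltry _) => i.
by rewrite !mxE; lra.
Qed.

(** After cutting [B] down to a cube [Q N], with [m] the measure left, an open [U] covers the part
    of the cube outside [B] with excess at most [m / 2]. Removing [U] from the cube leaves a compact
    subset of [B] of measure at least [m / 2]. *)
Lemma compact_subset_pos B : caratheodory_measurable lam B -> (0 < lam B)%E ->
  exists K, [/\ compact K, K `<=` B & (0 < lam K)%E].
Proof.
move=> mB B0.
pose Q (N : nat) := closed_box (const_mx (- N%:R)) (const_mx N%:R) : set 'rV[R]_n.+1.
have [N BN] : exists N, (0 < lam (B `&` Q N))%E.
  apply: contrapT => /forallNP nB; move: B0; apply/negP; rewrite -leNgt.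
  apply: (@le_trans _ _ (lam (\bigcup_N (B `&` Q N)))).
    apply: le_lebesgue_outer => x Bx.
    have xN := archi_boundP (normr_ge0 x).
    exists (Num.bound `|x|) => //; split=> // i; rewrite !mxE -ler_norml.
    exact: le_trans (row_entry_le_norm x i) (ltW xN).
  apply: le_trans (lebesgue_outer_sigma_subadditive _) _.
  rewrite eseries0// => N _ _; apply/eqP; rewrite eq_le lebesgue_outer_ge0 andbT.
  by rewrite leNgt; exact/negP/nB.
have Qoo : (lam (Q N) < +oo)%E.
  by apply: lebesgue_outer_compact_lty; exact: compact_closed_box.
have finS A : A `<=` Q N -> lam A \is a fin_num.
  move=> AQ; rewrite ge0_fin_numE ?lebesgue_outer_ge0//.
  exact: le_lt_trans (le_lebesgue_outer _ _ AQ) Qoo.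
have := mB (Q N); rewrite (setIC _ B).
have mfin := finS _ (@subIsetr _ B (Q N)).
have dfin := finS _ (@subIsetl _ (Q N) (~` B)).
move: BN; rewrite -(fineK mfin) -(fineK dfin) lte_fin.
set m := fine _; set d := fine _ => m0 QE.
have [U [oU BU lU]] :=
  lebesgue_outer_open (Q N `&` ~` B) (m / 2) (divr_gt0 m0 (ltr0n R 2)).
have KQ : Q N `&` ~` U `<=` Q N by apply: subIsetl.
exists (Q N `&` ~` U); split.
- by apply: compact_closedI; [exact: compact_closed_box|exact: open_closedC].
- move=> x [Qx nUx]; apply: contrapT => nBx; apply: nUx; exact: BU.
- have := fineK (finS _ KQ); move: (fine _) => k kE; rewrite -kE lte_fin.
  have : (lam (Q N) <= lam (Q N `&` ~` U) + lam U)%E.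
    apply: le_trans (outer_measureU2 lam _ _); apply: le_lebesgue_outer => x Qx.
    by have [Ux|nUx] := pselect (U x); [right|left].
  move=> /le_trans /(_ (leeD2l _ lU)); rewrite QE -kE -(fineK dfin) -/d.
  by rewrite -!EFinD lee_fin; lra.
Qed.

(* Steinhaus' argument: [K] has an open neighbourhood [U] with [U `\` K] small,
   and a small translate of the compact set [K] stays inside [U]. *)
Lemma lebesgue_outer_setI_shift K v : compact K -> (0 < lam K)%E ->
  \forall s \near (0 : R), (0 < lam (K `&` [set x | K (x + s *: v)%R]))%E.
Proof.
move=> cK K0; have Kfin : lam K \is a fin_num.
  by rewrite ge0_fin_numE ?lebesgue_outer_ge0// lebesgue_outer_compact_lty.
move: K0; rewrite -(fineK Kfin) lte_fin; set m := fine _ => m0.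
have [U [oU KU lU]] := lebesgue_outer_open K (m / 2) (divr_gt0 m0 (ltr0n R 2)).
have UK : (lam (U `&` ~` K) <= (m / 2)%:E)%E.
  have clK : closed K by apply: compact_closed => //; exact: norm_hausdorff.
  move: lU; rewrite (measurable_closed K clK U) (setIidr KU) -(fineK Kfin) -/m.
  by rewrite leeD2lE.
have /compact_near_coveringP cov := cK.
have : \forall s \near (0 : R), K `<=` [set x | U (x - s *: v)].
  apply: (cov R (nbhs (0 : R)) (fun s x => U (x - s *: v))) => x Kx.
  have /(_ (x, 0))/= cont : continuous (fun p : 'rV[R]_n.+1 * R => p.1 - p.2 *: v).
    move=> p; apply: cvgB; first exact: cvg_fst.
    by apply: cvgZr_tmp; exact: cvg_snd.
  have : nbhs (x - 0 *: v) U.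
    by rewrite scale0r subr0; apply: open_nbhs_nbhs; split=> //; exact: KU.
  by move=> /cont; rewrite /= nbhs_simpl /=.
apply: filterS => s Ks.
(* The translate of [K] by [- s *: v] has the measure of [K] and lies in [U]; its part outside [K]
   has measure at most [m / 2]. *)
have : (lam K <= lam (K `&` [set x | K (x + s *: v)%R]) + lam (U `&` ~` K))%E.
  rewrite -[leLHS](lebesgue_outer_addr K (s *: v)).
  apply: le_trans (outer_measureU2 lam _ _); apply: le_lebesgue_outer => x /= Kx.
  have Ux : U x by have := Ks _ Kx; rewrite /= addrK.
  by have [Kx'|nKx] := pselect (K x); [left|right].
move=> /le_trans /(_ (leeD2l _ UK)); rewrite -(fineK Kfin) -/m.
case: (lam _) => [r| |//]; last by rewrite ltry.
by rewrite -EFinD lee_fin lte_fin; lra.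
Qed.

End lebesgue_compact.

(** * Lower bound for the measure of the unit cube *)

Lemma sum_nat_ge_le {R : realType} (c : R) (M : nat) :
  \sum_(j < M) (c <= j%:R)%R%:R <= Num.max 0 (M%:R - c).
Proof.
elim: M => [|M IH]; first by rewrite big_ord0 le_max lexx.
rewrite big_ord_recr /=; have [cM|cM] := leP c M%:R.
  move: IH; rewrite max_r ?subr_ge0// max_r; last first.
    by rewrite subr_ge0 (le_trans cM)// ler_nat.
  by rewrite -[M.+1%:R]natr1 /=; lra.
rewrite addr0 (le_trans IH)// max_l; first by rewrite le_max lexx.
by rewrite subr_le0 ltW.
Qed.

Lemma sum_nat_itv_le {R : realType} (c d : R) (M : nat) : c <= d ->
  \sum_(j < M) (c <= j%:R <= d)%R%:R <= d - c + 1.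
Proof.
move=> cd; elim: M => [|M IH]; first by rewrite big_ord0; lra.
rewrite big_ord_recr /=; have [/andP[cM Md]|_] := boolP (c <= M%:R <= d); last first.
  by rewrite addr0.
(* When [M] itself is counted, the earlier integers above [c] number at most [M%:R - c], which
   leaves room for one more. *)
have : \sum_(j < M) (c <= j%:R <= d)%R%:R <= \sum_(j < M) (c <= j%:R)%R%:R :> R.
  by apply: ler_sum => j _; rewrite ler_nat; case: (c <= _) => //=; case: (_ <= d).
have := sum_nat_ge_le c M; rewrite max_r ?subr_ge0//=; lra.
Qed.

(* Double counting of the grid points [g / N], for [g] in [0, N)^n. *)
Lemma grid_cover_volume {R : realType} {n : nat} (M N : nat)
    (a b : nat -> 'rV[R]_n) : (0 < N)%N -> (forall k i, a k ord0 i <= b k ord0 i) ->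
  closed_box 0 (const_mx 1) `<=` \bigcup_(k in `I_M) closed_box (a k) (b k) ->
  1 <= \sum_(k < M) \prod_i (b k ord0 i - a k ord0 i + N%:R^-1).
Proof.
move=> N0 ab cover.
have NR : 0 < N%:R :> R by rewrite ltr0n.
(* Indicator that [j / N] lies in the [i]-th side of the box [k]; a grid point lies in that box when
   the product over [i] is 1. *)
pose chi k i (j : 'I_N) : R := (N%:R * a k ord0 i <= j%:R <= N%:R * b k ord0 i)%R%:R.
have chi_sum k i : \sum_j chi k i j <= N%:R * (b k ord0 i - a k ord0 i + N%:R^-1).
  rewrite mulrDr divff ?gt_eqF// mulrBr.
  by apply: sum_nat_itv_le; rewrite ler_wpM2l.
have : \sum_(g : {ffun 'I_n -> 'I_N}) 1 <=
    \sum_(g : {ffun 'I_n -> 'I_N}) \sum_(k < M) \prod_i chi k i (g i).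
  apply: ler_sum => g _.
  have [|k /= kM kg] := cover (\row_i ((g i)%:R / N%:R)).
    move=> i; rewrite !mxE divr_ge0 ?ler0n//= ler_pdivrMr// mul1r ler_nat.
    exact: ltnW.
  rewrite (bigD1 (Ordinal kM))//= big1 ?lerDl.
    by apply: sumr_ge0 => k' _; apply: prodr_ge0 => i _; exact: ler0n.
  move=> i _; have := kg i; rewrite mxE /chi ler_pdivrMr// ler_pdivlMr//.
  by rewrite (mulrC N%:R) (mulrC N%:R) => ->.
rewrite exchange_big /= sumr_const card_ffun !card_ord.
have le k : \sum_(g : {ffun 'I_n -> 'I_N}) \prod_i chi k i (g i) <=
    N%:R ^+ n * \prod_i (b k ord0 i - a k ord0 i + N%:R^-1).
  (* The number of grid points in a box factors into counts along the axes. *)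
  rewrite -bigA_distr_bigA /= -[n in _ ^+ n]card_ord -prodr_const -big_split /=.
  apply: ler_prod => i _; rewrite chi_sum andbT.
  by apply: sumr_ge0 => j _; exact: ler0n.
move=> /le_trans /(_ (ler_sum _ (fun k : 'I_M => fun=> le k))).
rewrite -mulr_sumr natrX -[leLHS]mulr1 ler_pM2l //; exact: exprn_gt0.
Qed.

Lemma pos_lower_bound {R : realType} (h : nat -> R) (M : nat) :
  (forall k, 0 < h k) -> exists2 d, 0 < d & forall k, (k < M)%N -> d <= h k.
Proof.
move=> h0; elim: M => [|M [d d0 dP]]; first by exists 1.
exists (Num.min d (h M)); first by rewrite lt_min d0 h0.
move=> k; rewrite ltnS leq_eqVlt => /predU1P[->|/dP dk].
  by rewrite ge_min lexx orbT.
by rewrite ge_min dk.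
Qed.

(** By compactness finitely many slightly enlarged boxes cover the cube, and counting grid points
    bounds their total volume from below. *)
Lemma lebesgue_outer_unit_box {R : realType} {n : nat} :
  (1 <= lebesgue_outer (closed_box (0 : 'rV[R]_n.+1) (const_mx 1))%R)%E.
Proof.
apply: le_ereal_inf_tmp => _ [a [b [ab Qab ->]]].
apply/lee_addgt0Pr => e e0.
have /choice[h hP] : forall k, exists h, 0 < h /\
    \prod_i (b k ord0 i - a k ord0 i + 3 * h) <=
    box_volume (a k) (b k) + e / (2 ^ k.+1)%:R.
  move=> k.
  have ek : 0 < e / (2 ^ k.+1)%:R :> R by rewrite divr_gt0// ltr0n expn_gt0.
  have [h h0 hP] := box_volume_enlarge (a k) (b k) _ 3 (ab k) ek (ltr0n R 3).
  by exists h.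
have h0 k : 0 < h k by case: (hP k).
pose V k := \bigcup_(y in closed_box (a k) (b k)) ball y (h k).
have : compact (closed_box (0 : 'rV[R]_n.+1) (const_mx 1)) by exact: compact_closed_box.
rewrite compact_cover => /(_ nat setT V)[||D _ QD].
- by move=> k _; apply: bigcup_open => y _; exact: ball_open.
- by move=> x /Qab[k _ kx]; exists k => //; exists x => //; exact: ballxx.
have [M DM] : exists M, forall k, k \in D -> (k < M)%N.
  exists (\max_(k <- D) k).+1 => k kD; rewrite ltnS.
  exact: (leq_bigmax_seq (F := id)).
(* The finitely many margins have a common lower bound [d], and [N] is taken so large that the grid
   step is at most [d]; this uses up the third [h]. *)
have [d d0 dh] := pos_lower_bound h M h0.
pose N := (Num.bound d^-1).+1.
have Nd : N%:R^-1 <= d.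
  rewrite -[d]invrK lef_pV2 ?posrE ?invr_gt0// ltW//.
  apply: lt_trans (archi_boundP _) _; first by rewrite invr_ge0 ltW.
  by rewrite ltr_nat.
have vol0 k : (0 <= (box_volume (a k) (b k))%:E)%E by rewrite lee_fin box_volume_ge0.
apply: le_trans (epsilon_trick _ vol0 (ltW e0)).
apply: le_trans (nneseries_lim_ge M _); last first.
  by move=> k _ _; rewrite adde_ge0// lee_fin divr_ge0// ltW.
rewrite big_mkord; under eq_bigr do rewrite -EFinD.
rewrite sumEFin lee_fin.
apply: le_trans (grid_cover_volume M N (fun k => a k - const_mx (h k))
  (fun k => b k + const_mx (h k)) isT _ _) _.
- by move=> k i; rewrite !mxE; have := ab k i; have := h0 k; lra.
- move=> x /QD[k /= kD [y ky]]; rewrite -ball_normE /= => yx.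
  exists k => [|i]; first exact: DM.
  have := row_entry_le_norm (y - x) i; have := ky i; rewrite !mxE ler_norml; lra.
- apply: ler_sum => k _; apply: le_trans (hP k).2; apply: ler_prod => i _.
  rewrite !mxE; have := ab k i; have := h0 k; have := dh k (ltn_ord k).
  have : 0 <= N%:R^-1 :> R by rewrite invr_ge0.
  by move: Nd; lra.
Qed.

(** * Cantor sets on lines *)

Lemma compact_nested_bigcap {T : topologicalType} (K : nat -> set T) :
  (forall k, compact (K k)) -> (forall k, closed (K k)) ->
  (forall k, K k !=set0) -> (forall k, K k.+1 `<=` K k) ->
  exists x, forall k, K k x.
Proof.
move=> cK clK K0 KS.
have /choice[u uK] : forall k, exists x, K k x by move=> k; exact: K0.
have Kle k m : (k <= m)%N -> K m `<=` K k.
  elim: m => [|m IH]; first by rewrite leqn0 => /eqP ->.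
  by rewrite leq_eqVlt => /predU1P[->//|/IH km] x /KS /km.
have uF k : (u @ \oo) (K k) by exists k => // m /= km; exact: (Kle _ _ km).
have [x [_ xcl]] := cK 0%N (u @ \oo) _ (uF 0%N).
exists x => k; apply: clK => B xB; exact: xcl.
Qed.

Section cantor_sums.
Context {R : realType} (s : nat -> R).
Hypothesis s_gt0 : forall k, 0 < s k.
Hypothesis s_third : forall k, s k.+1 <= s k / 3.
Implicit Types e : nat -> bool.

Definition subsum e m : R := \sum_(i < m) (if e i then s i else 0).

Definition cantor_sum e : R := limn (subsum e).

Lemma subsumS e m : subsum e m.+1 = subsum e m + (if e m then s m else 0).
Proof. by rewrite /subsum big_ord_recr. Qed.

(** Telescoping: the decay by a factor 3 gives [s i <= 3 / 2 * (s i - s i.+1)]. *)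
Lemma subsum_le e k m : (k <= m)%N ->
  subsum e k <= subsum e m <= subsum e k + 3 / 2 * (s k - s m).
Proof.
move=> /subnK <-; elim: (m - k)%N => [|d IH].
  by rewrite add0n lexx subrr mulr0 addr0 lexx.
rewrite addSn subsumS; have := s_gt0 (d + k); have := s_third (d + k).
move: IH => /andP[]; move: (s _.+1) (s (d + k)%N) (subsum e (d + k)) => t r q.
case: (e _); lra.
Qed.

Lemma subsum_nondecreasing e : nondecreasing_seq (subsum e).
Proof. by move=> k m km; have /andP[] := subsum_le e k m km. Qed.

Lemma subsum_le_tail e k m : subsum e m <= subsum e k + 3 / 2 * s k.
Proof.
have [km|/ltnW mk] := leqP k m.
  by have /andP[_] := subsum_le e k m km; have := s_gt0 m; lra.
by have := subsum_nondecreasing e _ _ mk; have := s_gt0 k; lra.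
Qed.

Lemma cvg_subsum e : subsum e @ \oo --> cantor_sum e.
Proof.
apply: nondecreasing_is_cvgn; first exact: subsum_nondecreasing.
exists (subsum e 0 + 3 / 2 * s 0) => _ [m _ <-]; exact: subsum_le_tail.
Qed.

Lemma cantor_sum_bounds e k :
  subsum e k <= cantor_sum e <= subsum e k + 3 / 2 * s k.
Proof.
have cv : cvgn (subsum e) := cvgP _ (cvg_subsum e).
apply/andP; split; first exact: nondecreasing_cvgn_le (subsum_nondecreasing e) cv k.
by apply: limr_le => //; near=> m; exact: subsum_le_tail.
Unshelve. all: by end_near. Qed.

(** The first differing digit decides: all terms after [s k] together contribute at most
    [s k / 2]. *)
Lemma cantor_sum_inj : injective cantor_sum.
Proof.
suff lt e e' k : (forall i, (i < k)%N -> e i = e' i) -> e k -> ~~ e' k ->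
    cantor_sum e' < cantor_sum e.
  move=> e e' ee'; apply/funext => k; elim/ltn_ind: k => k IH.
  case ek : (e k); case ek' : (e' k) => //.
    have := lt e e' k IH ek (negbT ek'); by rewrite ee' ltxx.
  have IH' i : (i < k)%N -> e' i = e i by move=> /IH.
  by have := lt e' e k IH' ek' (negbT ek); rewrite ee' ltxx.
move=> ee' ek /negbTE ek'.
have := cantor_sum_bounds e k.+1; have := cantor_sum_bounds e' k.+1.
rewrite !subsumS ek ek' addr0.
have -> : subsum e k = subsum e' k by apply: eq_bigr => i _; rewrite ee'.
have := s_gt0 k; have := s_third k; lra.
Qed.

End cantor_sums.

(* Iterating [K |-> K `&` (K - s v)] along rapidly decreasing [s] leaves a point
   [x] all of whose translates by subsums of the [s]'s, along [v], lie in [K]. *)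
Lemma compact_pos_cantor_line {R : realType} {n : nat} (K : set 'rV[R]_n.+1)
    (v : 'rV[R]_n.+1) :
  compact K -> (0 < lebesgue_outer K)%E ->
  exists (x : 'rV[R]_n.+1) (c : (nat -> bool) -> R),
    injective c /\ forall e, K (x + c e *: v).
Proof.
move=> cK K0.
have closedK (A : set 'rV[R]_n.+1) : compact A -> closed A.
  by apply: compact_closed; exact: norm_hausdorff.
pose shift (A : set 'rV[R]_n.+1) (s : R) := A `&` [set x | A (x + s *: v)].
pose good (A : set 'rV[R]_n.+1) := compact A /\ (0 < lebesgue_outer A)%E.
have /choice[f fP] : forall Ar : set 'rV[R]_n.+1 * R, exists s,
    good Ar.1 -> 0 < Ar.2 -> [/\ 0 < s, s <= Ar.2 / 3 & good (shift Ar.1 s)].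
  move=> [A r] /=; have [[[cA A0] r0]|nA] := pselect (good A /\ 0 < r); last first.
    by exists 0 => ? ?; case: nA.
  have /nbhs_ballP[d /= d0 dP] := lebesgue_outer_setI_shift A v cA A0.
  (* [d / 2] keeps the shift where the intersection has positive measure, and [r / 3] gives the
     decay required for injective sums. *)
  pose s := Num.min (d / 2) (r / 3).
  have s0 : 0 < s by rewrite lt_min !divr_gt0.
  have sr : s <= r / 3 by rewrite ge_min lexx orbT.
  have sd : s <= d / 2 by rewrite ge_min lexx.
  exists s => _ _; split=> //; split; last first.
    by apply: dP; rewrite -ball_normE /= sub0r normrN gtr0_norm//; lra.
  have cont : continuous (fun x : 'rV[R]_n.+1 => x + s *: v).
    by move=> x; apply: (cvgD (F := nbhs x)); [exact: cvg_id|exact: cvg_cst].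
  apply: compact_closedI => //.
  apply: (@closed_comp _ _ (fun x : 'rV[R]_n.+1 => x + s *: v) A); last exact: closedK.
  by move=> x _; exact: cont.
(* The state holds the current compact set and the last shift, which bounds the next one. *)
pose st := fix st k := if k is k'.+1 then
  (shift (st k').1 (f (st k')), f (st k')) else (K, 1 : R).
have stP k : good (st k).1 /\ 0 < (st k).2.
  elim: k => [|k [gk rk]]; first by split=> //=; exact: ltr01.
  by have [s0 _ gs] := fP (st k) gk rk.
pose s k := f (st k).
have s0 k : 0 < s k by have [gk rk] := stP k; have [] := fP (st k) gk rk.
have s3 k : s k.+1 <= s k / 3.
  by have [gk rk] := stP k.+1; have [] := fP (st k.+1) gk rk.
have [||||x xK] := @compact_nested_bigcap _ (fun k => (st k).1).
- by move=> k; have [[]] := stP k.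
- by move=> k; apply: closedK; have [[]] := stP k.
- move=> k; apply/set0P/negP => /eqP st0; have [[_]] := stP k.
  by rewrite st0 lebesgue_outer0 ltxx.
- by move=> k y [].
exists x, (cantor_sum s); split; first exact: cantor_sum_inj.
move=> e; have clK := closedK _ cK.
have xm m : K (x + subsum s e m *: v).
  (* Each set of the sequence, and its translate by the current shift, lie in the preceding set;
     undoing the stages one by one, either option may be taken. *)
  suff H k y : (st k).1 y -> K (y + subsum s e k *: v) by exact: H.
  elim: k y => [|k IH] y; first by rewrite /subsum big_ord0 scale0r addr0.
  move=> [Ky Kys]; rewrite subsumS; case: (e k); last by rewrite addr0; exact: IH.
  by rewrite scalerDl addrA addrAC; exact: IH.
have cv : (fun m => x + subsum s e m *: v) @ \oo --> x + cantor_sum s e *: v.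
  apply: cvgD; first exact: cvg_cst.
  by apply: cvgZr_tmp; exact: cvg_subsum.
by apply: (closed_cvg _ clK _ _ cv); apply: nearW => m; exact: xm.
Qed.

(** * Avoiding repeated distances *)

Lemma poly_roots_seq {F : fieldType} (p : {poly F}) :
  p != 0 -> exists rs : seq F, forall t, root p t -> t \in rs.
Proof.
have [m] := ubnP (size p); elim: m p => // m IH p pm p0.
have [[t rt]|nr] := pselect (exists t, root p t); last first.
  by exists [::] => t rt; case: nr; exists t.
have /factor_theorem[q pE] := rt.
have q0 : q != 0 by apply: contraNneq p0 => q0; rewrite pE q0 mul0r.
have [|//|rs rsP] := IH q.
  move: pm; rewrite pE size_Mmonic ?monicXsubC// size_XsubC addn2 /= ltnS.
  by apply: leq_trans.
exists (t :: rs) => u; rewrite pE rootM root_XsubC inE => /orP[/rsP->|->//].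
by rewrite orbT.
Qed.

Lemma embeds_preimage_seq {T : Type} {U : eqType} (c : T -> U) (A : set T)
    (rs : seq U) : injective c -> (forall e, A e -> c e \in rs) ->
  embeds A [set: nat].
Proof.
move=> ci Ars; exists (fun e => index (c e) rs) => // e e' /Ars ce /Ars ce' ii.
by apply: ci; rewrite -(nth_index (c e) ce) ii nth_index.
Qed.

Lemma enorm_eq {R : realType} {n : nat} (x y : 'rV[R]_n) :
  enorm x = enorm y -> \sum_i x ord0 i ^+ 2 = \sum_i y ord0 i ^+ 2.
Proof.
have s0 (z : 'rV[R]_n) : 0 <= \sum_i z ord0 i ^+ 2.
  by apply: sumr_ge0 => i _; exact: sqr_ge0.
by move=> /(congr1 (fun r => r ^+ 2)); rewrite !sqr_sqrtr.
Qed.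

Lemma sum_sqr_line {R : realType} {n : nat} (u v : 'I_n -> R) (t : R) :
  \sum_i (u i + t * v i) ^+ 2 =
  \sum_i u i ^+ 2 + (\sum_i u i * v i) *+ 2 * t + (\sum_i v i ^+ 2) * t ^+ 2.
Proof.
rewrite -sumrMnl !mulr_suml -!big_split /=; apply: eq_bigr => i _.
ring.
Qed.

Lemma cantor_embedding (R : realType) : exists c : (nat -> bool) -> R, injective c.
Proof.
exists (cantor_sum (fun k => 3^-1 ^+ k)); apply: cantor_sum_inj => k.
  by rewrite exprn_gt0.
by rewrite exprSr.
Qed.

(* With [x' = y'] the first case contains [x \in F]. *)
Definition repeats_distance {R : realType} {n : nat} (F : set 'rV[R]_n)
    (x : 'rV[R]_n) : Prop :=
  (exists y x' y', [/\ F y, F x', F y' & enorm (x - y) = enorm (x' - y')]) \/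
  (exists y y', [/\ F y, F y', y <> y' & enorm (x - y) = enorm (x - y')]).

(* The moment curve [t |-> (1, t, .., t^n)] meets a hyperplane through the
   origin in at most [n] points, so it contains a direction transverse to all
   the perpendicular bisectors. *)
Lemma transverse_direction {R : realType} {n : nat} (F : set 'rV[R]_n.+1) :
  ~ embeds [set: nat -> bool] F ->
  exists2 v : 'rV[R]_n.+1, 0 < \sum_i v ord0 i ^+ 2 &
    forall y y', F y -> F y' -> y <> y' ->
      \sum_i (y - y') ord0 i * v ord0 i != 0.
Proof.
move=> nF; have [c ci] := cantor_embedding R.
pose v e : 'rV[R]_n.+1 := \row_i c e ^+ i.
(* The third point of the triple is a dummy. *)
pose Rel e (p : 'rV[R]_n.+1 * 'rV[R]_n.+1 * 'rV[R]_n.+1) :=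
  p.1.1 <> p.1.2 /\ \sum_i (p.1.1 - p.1.2) ord0 i * v e ord0 i = 0.
have [|e eP] := not_embeds_cantor_fibers F Rel nF.
  move=> [[y y'] z] _; have [yy'|yy'] := pselect (y = y').
    by exists (fun=> 0%N) => // e e' [].
  (* The value of [p] at [c e] is the inner product of [y - y'] with [v e]. *)
  pose p := \poly_(i < n.+1) (y - y') ord0 (inord i).
  have p0 : p != 0.
    apply/eqP => p0; apply: yy'; apply/rowP => i.
    have := congr1 (fun q : {poly R} => q`_i) p0.
    rewrite coef_poly ltn_ord inord_val coef0 !mxE => /eqP.
    by rewrite subr_eq0 => /eqP.
  have [rs rsP] := poly_roots_seq p p0.
  apply: (embeds_preimage_seq c _ rs) => // e [_ /= sum0]; apply: rsP.
  apply/rootP; rewrite horner_poly -[RHS]sum0; apply: eq_bigr => i _.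
  by rewrite inord_val !mxE.
exists (v e).
  rewrite big_ord_recl mxE expr0 expr1n ltr_pwDl//.
  by apply: sumr_ge0 => i _; exact: sqr_ge0.
move=> y y' Fy Fy' yy'; apply/eqP => sum0.
by apply: (eP (y, y', y)) => //; split.
Qed.

Lemma compact_pos_avoids {R : realType} {n : nat} (K F : set 'rV[R]_n.+1) :
  compact K -> (0 < lebesgue_outer K)%E -> ~ embeds [set: nat -> bool] F ->
  exists x, ~ repeats_distance F x /\ K x.
Proof.
move=> cK K0 nF.
have [v v0 vF] := transverse_direction F nF.
have [x [c [ci cKx]]] := compact_pos_cantor_line K v cK K0.
pose z e := x + c e *: v.
have zE e y : \sum_i (z e - y) ord0 i ^+ 2 =
    \sum_i (x - y) ord0 i ^+ 2 + (\sum_i (x - y) ord0 i * v ord0 i) *+ 2 * c e +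
    (\sum_i v ord0 i ^+ 2) * c e ^+ 2.
  rewrite -sum_sqr_line; apply: eq_bigr => i _; rewrite !mxE; congr (_ ^+ 2).
  by ring.
(* One triple carries both obstructions: the sphere around its first point with radius the distance
   of the other two, and the bisector of its first two points. *)
pose Rel e (p : 'rV[R]_n.+1 * 'rV[R]_n.+1 * 'rV[R]_n.+1) :=
  enorm (z e - p.1.1) = enorm (p.1.2 - p.2) \/
  (p.1.1 <> p.1.2 /\ enorm (z e - p.1.1) = enorm (z e - p.1.2)).
have [|e eP] := not_embeds_cantor_fibers F Rel nF.
  move=> [[y y'] w] [[/= Fy Fy'] Fw].
  pose V := \sum_i v ord0 i ^+ 2.
  (* The sphere restricted to the line is a quadratic equation with leading coefficient [V], nonzero
     since [v] is. *)
  pose p : {poly R} := (\sum_i (x - y) ord0 i ^+ 2 - \sum_i (y' - w) ord0 i ^+ 2)%:P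
    + ((\sum_i (x - y) ord0 i * v ord0 i) *+ 2) *: 'X + V *: 'X^2.
  have p0 : p != 0.
    apply/eqP => /(congr1 (fun q : {poly R} => q`_2)).
    rewrite !coefE /= mulr0 !add0r mulr1 => V0.
    by move: v0; rewrite -/V V0 ltxx.
  have [rs rsP] := poly_roots_seq p p0.
  (* On a bisector the quadratic terms cancel, and transversality of [v] makes [t] the only
     solution. *)
  pose t := (\sum_i (x - y') ord0 i ^+ 2 - \sum_i (x - y) ord0 i ^+ 2) /
    ((\sum_i (y' - y) ord0 i * v ord0 i) *+ 2).
  apply: (embeds_preimage_seq c _ (t :: rs)) => // e [/enorm_eq|[yy' /enorm_eq]].
    rewrite zE /= => eq; rewrite inE rsP ?orbT//.
    by apply/rootP; rewrite /p !(hornerD, hornerC, hornerZ, hornerX, hornerXn) -eq /V;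
      ring.
  rewrite !zE /= => /addIr eq; rewrite inE; apply/orP; left; apply/eqP.
  have d0 : (\sum_i (y' - y) ord0 i * v ord0 i) *+ 2 != 0.
    by rewrite mulrn_eq0 /= vF// => /esym.
  apply: (mulIf d0); rewrite /t divfK//.
  have -> : \sum_i (y' - y) ord0 i * v ord0 i =
      \sum_i (x - y) ord0 i * v ord0 i - \sum_i (x - y') ord0 i * v ord0 i.
    by rewrite -sumrB; apply: eq_bigr => i _; rewrite !mxE; ring.
  by rewrite mulrnBl mulrBr; move: eq; lra.
exists (z e); split; last exact: cKx.
move=> [[y [x' [y' [Fy Fx' Fy' eq]]]]|[y [y' [Fy Fy' yy' eq]]]].
  by apply: (eP (y, x', y')) => //; left.
by apply: (eP (y, y', y)) => //; right.
Qed.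

(** Every closed set is the complement of a union of rational cubes, so [nat -> bool] can index the
    stages of the construction. *)
Definition closed_code (R : realType) (n : nat) (t : nat -> bool) : set 'rV[R]_n :=
  [set x | forall k, t k -> ~ rat_cube R n k x].

Lemma closed_codeP {R : realType} {n : nat} (K : set 'rV[R]_n) :
  closed K -> exists t, closed_code R n t = K.
Proof.
move=> cK; exists (fun k => `[< rat_cube R n k `<=` ~` K >]).
apply/seteqP; split=> [x xt|x Kx k /asboolP kK /kK//].
apply: contrapT => nKx.
have [k kx kK] := rat_cube_basis (~` K) x (closed_openC cK) nKx.
by apply: (xt k) => //; exact/asboolP.
Qed.

Lemma exists_full_outer_avoiding {R : realType} {n : nat} :
  exists E : set 'rV[R]_n.+1, avoids_repeated_distances E /\
    forall K, compact K -> (0 < lebesgue_outer K)%E -> (K `&` E) !=set0.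
Proof.
have box0 : (0 < lebesgue_outer (closed_box (0 : 'rV[R]_n.+1) (const_mx 1))%R)%E.
  by apply: lt_le_trans lebesgue_outer_unit_box; rewrite lte_fin ltr01.
pose P (t : nat -> bool) (F : set 'rV[R]_n.+1) x := ~ repeats_distance F x /\
  (compact (closed_code R n.+1 t) -> (0 < lebesgue_outer (closed_code R n.+1 t))%E ->
   closed_code R n.+1 t x).
have [||e [lt [lttr lttot eP]]] := @transfinite_choice (nat -> bool) 'rV[R]_n.+1 P.
- exact: inhabits (0 : 'rV[R]_n.+1).
- move=> t F nF; set C := closed_code R n.+1 t.
  have [[cC C0]|nC] := pselect (compact C /\ (0 < lebesgue_outer C)%E).
    by have [x [xF Cx]] := compact_pos_avoids C F cC C0 nF; exists x; split.
  (* Codes of other sets only need some point that repeats no distance, found here in the unit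
     box. *)
  have [x [xF _]] := compact_pos_avoids _ F (compact_closed_box _ _) box0 nF.
  by exists x; split=> // cC C0; case: nC.
exists (range e); split; last first.
  move=> K cK K0; have clK : closed K.
    by apply: compact_closed => //; exact: norm_hausdorff.
  have [t tK] := closed_codeP K clK.
  by exists (e t); have [_] := eP t; rewrite tK => /(_ cK K0).
have enormC (a b : 'rV[R]_n.+1) : enorm (a - b) = enorm (b - a).
  rewrite /enorm; congr Num.sqrt; apply: eq_bigr => i _.
  by rewrite !mxE -sqrrN opprB.
(* [q] is the last of the four stages, so the point chosen there would lie on a forbidden sphere. *)
have half q u q' u' : lt u q -> lt u' q' -> lt q' q ->
    enorm (e q - e u) = enorm (e q' - e u') -> False.
  move=> uq uq' qq' eq; have [nrep _] := eP q; apply: nrep; left.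
  exists (e u), (e q'), (e u'); split=> //.
  by apply: imageP; exact: lttr qq'.
(* With equal last stages, the common point would lie on the bisector of two distinct earlier
   points. *)
have main q u q' u' : lt u q -> lt u' q' ->
    enorm (e q - e u) = enorm (e q' - e u') -> e q = e q' /\ e u = e u'.
  move=> uq uq' eq; case: (lttot q q') => [qq'|qq'|qq'].
  - subst q'; split=> //; apply: contrapT => nuu.
    by have [nrep _] := eP q; apply: nrep; right; exists (e u), (e u').
  - by exfalso; exact: half uq' uq qq' (esym eq).
  - by exfalso; exact: half uq uq' qq' eq.
have ord q u : e q <> e u -> lt q u \/ lt u q.
  by case: (lttot q u) => [->//|?|?] _; [left|right].
move=> _ _ _ _ [q _ <-] [u _ <-] [q' _ <-] [u' _ <-] nqu nqu' nset eq.
case: (ord _ _ nqu) => uq; case: (ord _ _ nqu') => uq'.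
- by move: eq; rewrite enormC (enormC (e q')) => /(main _ _ _ _ uq uq')[eu eq];
    apply: nset; rewrite eu eq.
- by move: eq; rewrite enormC => /(main _ _ _ _ uq uq')[eu eq];
    apply: nset; rewrite eu eq setUC.
- by move: eq; rewrite (enormC (e q')) => /(main _ _ _ _ uq uq')[eu eq];
    apply: nset; rewrite eu eq setUC.
- by move: eq => /(main _ _ _ _ uq uq')[eu eq]; apply: nset; rewrite eu eq.
Qed.

(** * Hausdorff dimension *)

Lemma entry_le_enorm {R : realType} {n : nat} (x : 'rV[R]_n) i :
  `|x ord0 i| <= enorm x.
Proof.
rewrite -sqrtr_sqr /enorm ler_sqrt; last first.
  by apply: sumr_ge0 => j _; exact: sqr_ge0.
rewrite (bigD1 i)//= lerDl; apply: sumr_ge0 => j _; exact: sqr_ge0.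
Qed.

Lemma enorm_le_entries {R : realType} {n : nat} (x : 'rV[R]_n) (r : R) :
  (forall i, `|x ord0 i| <= r) -> 0 <= r -> enorm x <= n%:R * r.
Proof.
move=> xr r0; have nr0 : 0 <= n%:R * r by rewrite mulr_ge0.
rewrite -[leRHS](ger0_norm nr0) -sqrtr_sqr ler_sqrt ?sqr_ge0//.
apply: (@le_trans _ _ (\sum_(i < n) r ^+ 2)).
  by apply: ler_sum => i _; rewrite -real_normK ?num_real// lerXn2r// ?nnegrE.
rewrite sumr_const card_ord -[leLHS]mulr_natl exprMn ler_wpM2r ?sqr_ge0//.
by rewrite -natrX ler_nat; case: (n) => // m; rewrite expnS expn1 leq_pmulr.
Qed.

Lemma ediam_ge0 {R : realType} {n : nat} (U : set 'rV[R]_n) : (0 <= ediam U)%E.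
Proof. by rewrite le_max lexx. Qed.

Lemma enorm_le_ediam {R : realType} {n : nat} (U : set 'rV[R]_n) x y :
  U x -> U y -> ((enorm (x - y))%:E <= ediam U)%E.
Proof.
move=> Ux Uy; rewrite le_max; apply/orP; right.
by apply: ereal_sup_ubound; exists x, y.
Qed.

Lemma ediam_le {R : realType} {n : nat} (U : set 'rV[R]_n) (r : R) :
  0 <= r -> (forall x y, U x -> U y -> enorm (x - y) <= r) ->
  (ediam U <= r%:E)%E.
Proof.
move=> r0 Ur; rewrite ge_max lee_fin r0 /=.
by apply: ge_ereal_sup => _ [x [y [Ux Uy ->]]]; rewrite lee_fin Ur.
Qed.

Lemma diam_pow_ge0 {R : realType} {n : nat} (s : R) (U : set 'rV[R]_n) :
  (0 <= diam_pow s U)%E.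
Proof. by rewrite /diam_pow; case: ifP => // _; exact: poweR_ge0. Qed.

Lemma diam_pow_le {R : realType} {n : nat} (s : R) (U : set 'rV[R]_n) (r : R) :
  0 <= s -> 0 <= r -> (ediam U <= r%:E)%E -> (diam_pow s U <= (r `^ s)%:E)%E.
Proof.
move=> s0 r0 Ur; rewrite /diam_pow; case: ifP => _; first by rewrite lee_fin powR_ge0.
rewrite -poweR_EFin; apply: gt0_ler_poweR => //;
  by rewrite in_itv/= ?ediam_ge0 ?lee_fin ?r0 leey.
Qed.

Lemma hausdorff_premeasureE {R : realType} {n : nat} (s d : R)
    (A : set 'rV[R]_n) :
  hausdorff_premeasure s d A =
  cover_inf [set U | (ediam U <= d%:E)%E] id (diam_pow s) A.
Proof. by []. Qed.

(** A set of diameter [d <= 1] lies in a cube of side [2 * d] around any of its points, of volume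
    [2 ^+ n.+1 * d ^+ n.+1]. Since [s <= n.+1%:R], this is at most [c] times [d] to the power
    [s]. *)
Lemma hausdorff_measure0_lebesgue_outer0 {R : realType} {n : nat} (s : R)
    (A : set 'rV[R]_n.+1) : s <= n.+1%:R ->
  hausdorff_measure s A = 0%E -> lebesgue_outer A = 0%E.
Proof.
move=> sn HA0; apply/eqP; rewrite eq_le lebesgue_outer_ge0 andbT.
have pA0 : (hausdorff_premeasure s 1 A <= 0)%E.
  by rewrite -HA0; apply: ereal_sup_ubound; exists 1 => //=; exact: ltr01.
apply/lee_addgt0Pr => e e0; rewrite add0e.
pose c : R := 2 ^+ n.+1.
have c0 : 0 < c by rewrite exprn_gt0.
have [|U [Ud AU]] := cover_inf_adherent [set U | (ediam U <= 1%:E)%E] id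
  (@diam_pow R n.+1 s) (fun U _ => diam_pow_ge0 s U) A _ (divr_gt0 e0 c0).
  by rewrite -hausdorff_premeasureE (le_lt_trans pA0).
rewrite -hausdorff_premeasureE => Ue.
have {}Ue : (\sum_(0 <= k <oo) diam_pow s (U k) <= (e / c)%:E)%E.
  by apply: le_trans Ue _; rewrite -[leRHS]add0e leeD2r.
have /choice[ab abP] : forall k, exists ab : 'rV[R]_n.+1 * 'rV[R]_n.+1,
    [/\ forall i, ab.1 ord0 i <= ab.2 ord0 i, U k `<=` closed_box ab.1 ab.2 &
        ((box_volume ab.1 ab.2)%:E <= c%:E * diam_pow s (U k))%E].
  move=> k; have [U0|/eqP/set0P[x Ux]] := pselect (U k = set0).
    exists (0, 0); split=> //; first by rewrite U0.
    rewrite /box_volume big_ord_recl subrr mul0r mule_ge0 ?diam_pow_ge0//.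
    by rewrite lee_fin ltW.
  have dfin : ediam (U k) \is a fin_num.
    by rewrite ge0_fin_numE ?ediam_ge0// (le_lt_trans (Ud k)) ?ltry.
  have := Ud k; have := ediam_ge0 (U k); have := fineK dfin.
  rewrite /=; set d := fine _ => dE; rewrite -dE !lee_fin => d0 d1.
  exists (x - const_mx d, x + const_mx d); split=> [i|y Uy i|] /=.
  - by rewrite !mxE; lra.
  - have := enorm_le_ediam (U k) y x Uy Ux; rewrite -dE lee_fin.
    by have := entry_le_enorm (y - x) i; rewrite !mxE ler_norml; lra.
  - rewrite /diam_pow; case: ifPn => [/asboolP U0|_].
      by rewrite U0 in Ux.
    rewrite -dE poweR_EFin -EFinM lee_fin.
    rewrite /box_volume (eq_bigr (fun=> 2 * d)); last first.
      by move=> i _; rewrite !mxE; ring.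
    rewrite prodr_const card_ord exprMn ler_pM2l//.
    move: d0; rewrite le_eqVlt => /predU1P[<-|d0].
      by rewrite expr0n /= powR_ge0.
    by rewrite -powR_mulrn ?(ltW d0)// ger_powR// d0.
apply: le_trans (lebesgue_outer_le_cover _ (fst \o ab) (snd \o ab) _ _) _.
- by move=> k i; have [] := abP k.
- move=> x /AU[k _ Ukx]; exists k => //; have [_ sub _] := abP k; exact: sub.
- apply: (@le_trans _ _ (\sum_(0 <= k <oo) (c%:E * diam_pow s (U k)))%E).
    apply: lee_nneseries => [k _ _|k _]; last by have [] := abP k.
    by rewrite lee_fin box_volume_ge0// => i; have [] := abP k.
  rewrite nneseriesZl; last by move=> k _; exact: diam_pow_ge0.
  apply: le_trans (lee_wpmul2l _ Ue) _; first by rewrite lee_fin ltW.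
  by rewrite -EFinM lee_fin mulrCA divff ?mulr1// gt_eqF.
Qed.

Lemma ex_subinterval {R : realType} (N : nat) (h t : R) :
  0 <= t <= N.+1%:R * h -> exists j : 'I_N.+1, j%:R * h <= t <= j.+1%:R * h.
Proof.
elim: N => [|N IH] /andP[t0 tN]; first by exists ord0; rewrite mul0r t0 tN.
have [tN'|/ltW tN'] := leP t (N.+1%:R * h).
  have [|j jt] := IH; first by rewrite t0.
  by exists (widen_ord (leqnSn _) j).
by exists ord_max; rewrite tN'.
Qed.

Lemma hausdorff_premeasure_le_finite {R : realType} {n : nat} (J : finType)
    (s d : R) (A : set 'rV[R]_n) (W : J -> set 'rV[R]_n) (r : R) :
  0 <= s -> 0 <= r <= d -> A `<=` \bigcup_j W j ->
  (forall j, (ediam (W j) <= r%:E)%E) ->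
  (hausdorff_premeasure s d A <= (#|J|%:R * r `^ s)%:E)%E.
Proof.
move=> s0 /andP[r0 rd] AW Wr.
(* The finite cover is padded with empty sets, which contribute 0 even for [s = 0]. *)
pose U (k : nat) := if insub k is Some i then W (enum_val (i : 'I_#|J|)) else set0.
have U0 k : (#|J| <= k)%N -> U k = set0.
  by move=> Jk; rewrite /U insubF// ltnNge Jk.
have Ur k : (ediam (U k) <= r%:E)%E.
  by rewrite /U; case: insubP => [i _ _//|_]; apply: ediam_le.
apply: le_trans (cover_inf_le_cover [set V | (ediam V <= d%:E)%E] id
  (diam_pow s) A U _ _) _.
- by move=> k /=; apply: le_trans (Ur k) _; rewrite lee_fin.
- move=> x /AW[j _ Wj]; exists (enum_rank j) => //=.
  by rewrite /U valK enum_rankK.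
- rewrite (nneseries_split 0 #|J|); last by move=> k _; exact: diam_pow_ge0.
  rewrite add0n [X in (_ + X)%E]eseries0 ?adde0; last first.
    by move=> k Jk _; rewrite U0// /diam_pow; case: ifPn => // /asboolP.
  apply: (@le_trans _ _ (\sum_(0 <= k < #|J|) (r `^ s)%:E)%E).
    by apply: lee_sum => k _; exact: diam_pow_le.
  by rewrite sumEFin lee_fin sumr_const_nat subn0 mulr_natl.
Qed.

(** Subdividing each side into [N.+1] parts gives a sum of at most [C] to the power [s] times [N.+1]
    to the power [n.+1 - s], which tends to 0. *)
Lemma hausdorff_premeasure_cube {R : realType} {n : nat} (s d : R) (m : nat) :
  n.+1%:R < s -> 0 < d ->
  hausdorff_premeasure s d
    (closed_box (const_mx (- m%:R)) (const_mx m%:R) : set 'rV[R]_n.+1) = 0%E.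
Proof.
move=> ns d0; apply/eqP; rewrite eq_le; apply/andP; split; last first.
  by rewrite hausdorff_premeasureE; apply: cover_inf_ge0 => *; exact: diam_pow_ge0.
have s0 : 0 <= s by apply: le_trans (ltW ns).
apply/lee_addgt0Pr => e e0; rewrite add0e.
pose C : R := n.+1%:R * (2 * m%:R).
have C0 : 0 <= C by rewrite !mulr_ge0.
pose t := s - n.+1%:R; have t0 : 0 < t by rewrite subr_gt0.
(* The first term makes the diameters at most [d], the second the sum at most [e]. *)
pose B := C / d + (C `^ s / e) `^ t^-1.
have B0 : 0 <= B by rewrite addr_ge0 ?powR_ge0// divr_ge0// ltW.
pose N := Num.bound B.
have NB : B <= N.+1%:R.
  by apply: ltW; apply: lt_trans (archi_boundP B0) _; rewrite ltr_nat.
have NR : 0 < N.+1%:R :> R by rewrite ltr0n.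
pose h : R := 2 * m%:R / N.+1%:R.
have h0 : 0 <= h by rewrite divr_ge0// mulr_ge0.
pose W (g : {ffun 'I_n.+1 -> 'I_N.+1}) : set 'rV[R]_n.+1 :=
  closed_box (\row_i (- m%:R + (g i)%:R * h)) (\row_i (- m%:R + (g i).+1%:R * h)).
have Chd : C / N.+1%:R <= d.
  rewrite ler_pdivrMr// mulrC -ler_pdivrMr//; apply: le_trans NB.
  by rewrite lerDl powR_ge0.
apply: le_trans (hausdorff_premeasure_le_finite _ s d _ W (C / N.+1%:R) s0 _ _ _) _.
- by rewrite Chd divr_ge0.
- move=> x xm.
  have /choice[g gP] : forall i, exists j : 'I_N.+1,
      j%:R * h <= x ord0 i + m%:R <= j.+1%:R * h.
    move=> i; apply: ex_subinterval; have := xm i; rewrite !mxE.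
    rewrite /h mulrCA divff ?gt_eqF// mulr1; lra.
  exists (finfun g) => // i; have := gP i; rewrite !mxE ffunE; lra.
- move=> g; apply: ediam_le => [|x y xg yg]; first by rewrite divr_ge0.
  rewrite /C -mulrA; apply: enorm_le_entries => // i.
  have := xg i; have := yg i; rewrite !mxE ler_norml -/h -natr1; lra.
- rewrite card_ffun !card_ord lee_fin natrX powRM ?invr_ge0// -powR_mulrn//.
  rewrite -[N.+1%:R^-1]powR_inv1// -powRrM mulN1r mulrCA -powRD; last first.
    by rewrite (lt0r_neq0 NR) implybT.
  have -> : n.+1%:R - s = - t by rewrite /t opprB.
  rewrite powRN ler_pdivrMr ?powR_gt0// mulrC -ler_pdivrMr//.
  have -> : C `^ s / e = ((C `^ s / e) `^ t^-1) `^ t.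
    by rewrite -powRrM mulVf ?gt_eqF// powRr1// divr_ge0 ?powR_ge0// ltW.
  apply: ge0_ler_powR; rewrite ?nnegrE ?powR_ge0// ?(ltW t0)//.
  by apply: le_trans NB; rewrite lerDr divr_ge0// ltW.
Qed.

Lemma hausdorff_measure_eq0 {R : realType} {n : nat} (s : R)
    (A : set 'rV[R]_n.+1) : n.+1%:R < s -> hausdorff_measure s A = 0%E.
Proof.
move=> ns; have w0 (U : set 'rV[R]_n.+1) : (0 <= diam_pow s U)%E by exact: diam_pow_ge0.
suff prem0 d : 0 < d -> hausdorff_premeasure s d A = 0%E.
  apply/eqP; rewrite eq_le; apply/andP; split.
    by apply: ge_ereal_sup => _ [d d0 <-]; rewrite prem0.
  rewrite -(prem0 1 ltr01); apply: ereal_sup_ubound; exists 1 => //.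
  exact: ltr01.
move=> d0; apply/eqP; rewrite eq_le; apply/andP; split; last first.
  by rewrite hausdorff_premeasureE; apply: cover_inf_ge0 => *; exact: w0.
pose Q (m : nat) : set 'rV[R]_n.+1 := closed_box (const_mx (- m%:R)) (const_mx m%:R).
apply: (@le_trans _ _ (hausdorff_premeasure s d (\bigcup_m Q m))).
  rewrite !hausdorff_premeasureE; apply: le_cover_inf => x _.
  have xm := archi_boundP (normr_ge0 x).
  exists (Num.bound `|x|) => // i; rewrite !mxE -ler_norml.
  exact: le_trans (row_entry_le_norm x i) (ltW xm).
rewrite hausdorff_premeasureE.
apply: le_trans (cover_inf_bigcup _ _ _ (fun U _ => w0 U) _) _.
rewrite eseries0// => m _ _; exact: hausdorff_premeasure_cube.
Qed.

Lemma hausdorff_dim_full_outer {R : realType} {n : nat} (E : set 'rV[R]_n.+1) :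
  lebesgue_outer E <> 0%E -> hausdorff_dim E = (n.+1%:R)%:E.
Proof.
move=> E0; apply/eqP; rewrite eq_le; apply/andP; split.
  apply/lee_addgt0Pr => e e0; apply: ereal_inf_lbound; exists (n.+1%:R + e) => //.
  split; first by rewrite addr_ge0// ltW.
  by apply: hausdorff_measure_eq0; rewrite ltrDl.
apply: le_ereal_inf_tmp => _ [s [s0 Hs] <-]; rewrite lee_fin leNgt; apply/negP => sn.
by apply: E0; exact: hausdorff_measure0_lebesgue_outer0 (ltW sn) Hs.
Qed.

(** * Inner measure of the complement *)

Lemma lebesgue_inner_setC_eq0 {R : realType} {n : nat} (E : set 'rV[R]_n.+1) :
  (forall K, compact K -> (0 < lebesgue_outer K)%E -> (K `&` E) !=set0) ->
  lebesgue_inner (~` E) = 0%E.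
Proof.
move=> EK; apply/eqP; rewrite eq_le; apply/andP; split; last first.
  rewrite -(@lebesgue_outer0 R n); apply: ereal_sup_ubound; exists set0 => //.
  by split=> //; exact: caratheodory_measurable_set0.
apply: ge_ereal_sup => _ [B [mB BE] <-]; rewrite leNgt; apply/negP => B0.
have [K [cK KB K0]] := compact_subset_pos B mB B0.
by have [x [Kx Ex]] := EK K cK K0; exact: BE (KB _ Kx) Ex.
Qed.

(** A null [E] would be measurable, and so would its complement, which the inner measure would then
    force to be null; the unit box would be null too. *)
Lemma lebesgue_inner_setC_outer_neq0 {R : realType} {n : nat}
    (E : set 'rV[R]_n.+1) :
  lebesgue_inner (~` E) = 0%E -> lebesgue_outer E <> 0%E.
Proof.
move=> EC0 E0.
have mE : caratheodory_measurable (@lebesgue_outer R n.+1) E.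
  apply: le_caratheodory_measurable => X /=.
  rewrite [X in (X + _)%E](_ : _ = 0%E) ?add0e; last first.
    apply/eqP; rewrite eq_le lebesgue_outer_ge0 andbT -E0.
    by apply: le_lebesgue_outer; exact: subIsetr.
  by apply: le_lebesgue_outer; exact: subIsetl.
have C0 : (lebesgue_outer (~` E) <= 0)%E.
  rewrite -EC0; apply: ereal_sup_ubound; exists (~` E) => //; split=> //.
  exact: (caratheodory_measurable_setC mE).
have := @lebesgue_outer_unit_box R n; apply/negP; rewrite -ltNge.
apply: (@le_lt_trans _ _ (lebesgue_outer (E `|` ~` E))).
  by apply: le_lebesgue_outer; rewrite setUCr.
apply: le_lt_trans (outer_measureU2 _ _ _) _ => /=.
by rewrite E0 add0e (le_lt_trans C0)// lte_fin ltr01.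
Qed.

Theorem theorem6p6 (R : realType) (n : nat) (hn : (1 <= n)%N) :
  exists E : set 'rV[R]_n,
    [/\ avoids_repeated_distances E,
        lebesgue_inner (~` E) = 0%E
      & hausdorff_dim E = (n%:R)%:E].
Proof.
case: n hn => // n _.
have [E [avE EK]] := @exists_full_outer_avoiding R n.
have EC0 := lebesgue_inner_setC_eq0 E EK.
exists E; split=> //.
exact/hausdorff_dim_full_outer/lebesgue_inner_setC_outer_neq0.
Qed.
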